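(* Let a random open interval system with admissible potential, satisfying all the standing assumptions listed in the context (including (Q1), (Q2), (Q3)), be given, with associated $\lambda,\nu,\phi,\eta$. Then for $m$-a.e. $\omega\in\Omega$ the escape rates $R(\nu_{\omega,0})$ and $R(\eta_\omega)$ exist and $$R(\nu_{\omega,0})=R(\eta_\omega)=\mathcal{E}P(\varphi_0)-\mathcal{E}P(\varphi)=\int_\Omega\log\frac{\lambda_{\omega,0}}{\lambda_\omega}\,dm(\omega).$$
   Context: **Base and maps.** $(\Omega,\mathscr F,m)$ is a probability space, $\sigma:\Omega\to\Omega$ is invertible, ergodic and preserves $m$. $I\subset\mathbb R$ is a compact interval with Borel $\sigma$-algebra $\mathscr B$. For each $\omega$, $T_\omega:I\to I$ is surjective and $\mathcal Z_\omega$ is a finite partition of $I$ into intervals such that for each $Z\in\mathcal Z_\omega$, $T_\omega(Z)$ is an interval and $T_\omega|_Z$ is continuous and strictly monotone; $\log\#\mathcal Z_\omega\in L^1(m)$. Put $T_\omega^n=T_{\sigma^{n-1}\omega}\circ\dots\circ T_\omega$, $\mathcal Z_\omega^{(n)}=\bigvee_{j=0}^{n-1}T_\omega^{-j}(\mathcal Z_{\sigma^j\omega})$; the partitions generate: $\bigvee_{n\ge1}\mathcal Z_\omega^{(n)}=\mathscr B$. The skew product $T(\omega,x)=(\sigma\omega,T_\omega x)$ on $\Omega\times I$ is measurable. **Functions and measures.** $\mathrm{var}_A(f)$ is the total variation of $f$ over $A\subseteq I$, $\mathrm{var}=\mathrm{var}_I$; $\mathrm{BV}(I)$ is the set of bounded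 $f:I\to\mathbb R$ with $\mathrm{var}(f)<\infty$; $\|f\|_\infty=\sup|f|$. For $f:\Omega\times I\to\mathbb R$ write $f_\omega=f(\omega,\cdot)$. $\mathrm{BV}_\Omega(I)$ is the set of $f:\Omega\times I\to\mathbb R$ with $f_\omega\in \mathrm{BV}(I)$ for all $\omega$, $\omega\mapsto f_\omega(x)$ measurable for each $x$, and $\omega\mapsto\|f_\omega\|_\infty$, $\omega\mapsto\mathrm{var}(f_\omega)$ measurable. A random probability measure $\zeta=\{\zeta_\omega\}$ on $\Omega\times I$ is a probability measure with marginal $m$ on $\Omega$, identified with its disintegration $\{\zeta_\omega\}$ into Borel probability measures on $I$. **Closed system.** $\varphi_0:\Omega\times I\to\mathbb R$ is a measurable potential with $\inf\varphi_{\omega,0},\sup\varphi_{\omega,0}\in L^1(m)$ and $g_{\omega,0}:=e^{\varphi_{\omega,0}}\in \mathrm{BV}(I)$ for $m$-a.e. $\omega$. Put $g_{\omega,0}^{(n)}=\prod_{j=0}^{n-1}g_{\sigma^j\omega,0}\circ T_\omega^j$ and $\mathcal L_{\omega,0}f(x)=\sum_{y\in T_\omega^{-1}(x)}g_{\omega,0}(y)f(y)$. There exist a random probability measure $\nu_0=\{\nu_{\omega,0}\}$ with non-atomic fibre measures, a measurable $\lambda_0:\Omega\to\mathbb R\setminus\{0\}$ and $\phi_0\in \mathrm{BV}_\Omega(I)$ with values in $(0,\infty)$ such that $\mathcal L_{\omega,0}\phi_{\omega,0}=\lambda_{\omega,0}\phi_{\sigma\omega,0}$, $\nu_{\sigma\omega,0}(\mathcal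 L_{\omega,0}f)=\lambda_{\omega,0}\nu_{\omega,0}(f)$ for $f\in \mathrm{BV}(I)$, $\lambda_{\omega,0}=\nu_{\sigma\omega,0}(\mathcal L_{\omega,0}\mathbf 1)$, $\log\lambda_{\omega,0}\in L^1(m)$; and $\mu_{\omega,0}:=\phi_{\omega,0}\nu_{\omega,0}$ defines a $T$-invariant random probability measure. **Holes.** $H\subseteq\Omega\times I$ is $\mathscr F\otimes\mathscr B$-measurable with $0<\nu_0(H)<1$ and fibres $H_\omega$; $I_\omega=I\setminus H_\omega$, $\mathbf 1_\omega=\mathbf 1_{I_\omega}$. $X_{\omega,n}=\{x\in I:T_\omega^j(x)\notin H_{\sigma^j\omega},\,0\le j\le n\}$, $X_{\omega,\infty}=\bigcap_nX_{\omega,n}$. Let $\varphi_\omega=\varphi_{\omega,0}|_{I_\omega}$ (open potential $\varphi$), $g_\omega^{(n)}=g_{\omega,0}^{(n)}\mathbf 1_{X_{\omega,n-1}}$, $\mathcal L_\omega f=\mathcal L_{\omega,0}(f\mathbf 1_\omega)$, $\mathcal L_\omega^n=\mathcal L_{\sigma^{n-1}\omega}\circ\dots\circ\mathcal L_\omega$. Let $D_{\omega,n}=\{x:\mathcal L^n_{\sigma^{-n}\omega}\mathbf 1_{\sigma^{-n}\omega}(x)\ne0\}$ and $D_{\omega,\infty}=\bigcap_nD_{\omega,n}$. It is assumed that $X_{\omega,\infty}\neq\emptyset$ and $D_{\omega,\infty}\ne\emptyset$ for $m$-a.e. $\omega$. **Functional and assumptions (Q1)–(Q3).** For $f\in \mathrm{BV}(I)$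 let $\Lambda_\omega(f)=\lim_{n\to\infty}\inf_{x\in D_{\sigma^n\omega,n}}\frac{\mathcal L_\omega^nf(x)}{\mathcal L_\omega^n\mathbf 1_\omega(x)}$ (a limit of a bounded increasing sequence), $\rho_\omega=\Lambda_{\sigma\omega}(\mathcal L_\omega\mathbf 1_\omega)$ and $\rho_\omega^n=\prod_{j=0}^{n-1}\rho_{\sigma^j\omega}$. For each $\omega,n$ fix a finite partition $\mathcal A$ of $I$ with $\mathrm{var}_A(g_\omega^{(n)})\le2\|g_\omega^{(n)}\|_\infty$ for all $A\in\mathcal A$; let $\widehat{\mathcal Z}_\omega^{(n)}$ be the coarsest partition (into intervals) among those finer than $\mathcal A$ and $\mathcal Z_\omega^{(n)}$ all of whose elements are either disjoint from or contained in $X_{\omega,n-1}$. Let $\mathcal Z_{\omega,*}^{(n)}=\{Z\in\widehat{\mathcal Z}_\omega^{(n)}:Z\subseteq X_{\omega,n-1}\}$, $\mathcal Z_{\omega,b}^{(n)}=\{Z\in\mathcal Z_{\omega,*}^{(n)}:\Lambda_\omega(\mathbf 1_Z)=0\}$, $\mathcal Z_{\omega,g}^{(n)}=\{Z\in\mathcal Z_{\omega,*}^{(n)}:\Lambda_\omega(\mathbf 1_Z)>0\}$. Two elements of $\mathcal Z_{\omega,*}^{(n)}$ are contiguous if they share a boundary point or are separated by a connected component of $\bigcup_{j=0}^{n-1}T_\omega^{-j}(H_{\sigma^j\omega})$. Let $\xi_\omega^{(n)}$ be the maximum number of contiguous elements of $\mathcal Z_{\omega,b}^{(n)}$. Assume: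 (Q1) $\lim_{n}\frac1n\log\|g_\omega^{(n)}\|_\infty+\limsup_n\frac1n\log\xi_\omega^{(n)}<\lim_n\frac1n\log\rho_\omega^n=\int_\Omega\log\rho_\omega\,dm(\omega)$; (Q2) $\log\xi_\omega^{(n)}\in L^1(m)$ for each $n\in\mathbb N$; (Q3) $\log\delta_{\omega,n}\in L^1(m)$ for each $n\in\mathbb N$, where $\delta_{\omega,n}=\min_{Z\in\mathcal Z_{\omega,g}^{(n)}}\Lambda_\omega(\mathbf 1_Z)$. **Associated objects** (which exist under these assumptions). $\nu_\omega$ is the Borel probability measure, with support in $X_{\omega,\infty}$, representing $\Lambda_\omega$, i.e. $\Lambda_\omega(f)=\int f\,d\nu_\omega$ for $f\in \mathrm{BV}(I)$; it satisfies $\nu_{\sigma\omega}(\mathcal L_\omega f)=\lambda_\omega\nu_\omega(f)$ with $\lambda_\omega=\rho_\omega=\nu_{\sigma\omega}(\mathcal L_\omega\mathbf 1_\omega)$, and $\log\lambda_\omega\in L^1(m)$. The density $\phi\in \mathrm{BV}_\Omega(I)$ is given by the uniform limit $\phi_\omega=\lim_{n\to\infty}\mathcal L^n_{\sigma^{-n}\omega}\mathbf 1_{\sigma^{-n}\omega}/\Lambda_\omega(\mathcal L^n_{\sigma^{-n}\omega}\mathbf 1_{\sigma^{-n}\omega})$ and satisfies $\mathcal L_\omega\phi_\omega=\lambda_\omega\phi_{\sigma\omega}$, $\nu_\omega(\phi_\omega)=1$. Further $\eta_\omega(f)=\nu_{\omega,0}(\mathbf 1_\omega\phi_\omega f)/\nu_{\omega,0}(\mathbf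 1_\omega\phi_\omega)$. **Pressures and escape rates.** $\mathcal{E}P(\varphi_0)=\int_\Omega\log\lambda_{\omega,0}\,dm(\omega)$ and $\mathcal{E}P(\varphi)=\int_\Omega\log\lambda_\omega\,dm(\omega)$. For a random probability measure $\zeta$, $\underline R(\zeta_\omega)=-\limsup_{n\to\infty}\frac1n\log\zeta_\omega(X_{\omega,n})$ and $\overline R(\zeta_\omega)=-\liminf_{n\to\infty}\frac1n\log\zeta_\omega(X_{\omega,n})$; if equal, the escape rate exists and $R(\zeta_\omega)$ denotes the common value. *)

(* Defs.v *)
From HB Require Import structures.
From mathcomp Require Export all_boot all_order all_algebra.
From mathcomp Require Export all_classical all_reals all_analysis.
From mathcomp Require Export finmap measurable_realfun.

Set Implicit Arguments.
Unset Strict Implicit.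
Unset Printing Implicit Defensive.

Export Order.TTheory GRing.Theory Num.Theory.
Export numFieldNormedType.Exports.

#[global] Open Scope classical_set_scope.
#[global] Open Scope ring_scope.

Section functions_on_an_interval.
Context {R : realType}.
Implicit Types (A I : set R) (f : R -> R) (P Q : set (set R)).

Definition sup_norm I f : \bar R := ereal_sup [set `|f x|%:E | x in I].

(* Total variation over an arbitrary set A: the points of the subdivision,
   x and the elements of s, all lie in A. *)
Definition var_on A f : \bar R :=
  ereal_sup [set v | exists x y s, [/\ itv_partition x y s,
    (forall z, z \in x :: s -> A z) & v = (variation x y f s)%:E]].

Definition BV I f : Prop :=
  (sup_norm I f < +oo)%E /\ (var_on I f < +oo)%E.

Definition set_partition I P : Prop := partition P id I.

Definition interval_partition I P : Prop :=
  set_partition I P /\ (forall A, P A -> is_interval A).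

Definition finer P Q : Prop := forall A, P A -> exists2 B, Q B & A `<=` B.

Definition pjoin P Q : set (set R) :=
  [set C | C !=set0 /\ exists2 A, P A & exists2 B, Q B & C = A `&` B].

Definition boundary A : set R := closure A `\` interior A.

Definition gap A B : set R :=
  [set x | (forall y, A y -> y < x) /\ (forall y, B y -> x < y)].

End functions_on_an_interval.

Definition BVOmega d (Omega : measurableType d) (R : realType)
    (I : set R) (f : Omega -> R -> R) : Prop :=
  [/\ forall w, BV I (f w),
      forall x, I x -> measurable_fun setT (fun w => f w x),
      measurable_fun setT (fun w => sup_norm I (f w)) &
      measurable_fun setT (fun w => var_on I (f w))].

(* lne is -oo on ]-oo, 0] and +oo at +oo, so this forces 0 < u < +oo a.e. *)
Definition log_integrable d (Omega : measurableType d) (R : realType)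
    (m : probability Omega R) (u : Omega -> \bar R) : Prop :=
  m.-integrable setT (fun w => lne (u w)).

(* The data of a random open interval system; I = [lo, hi], and functions on I
   are functions R -> R of which only the restriction to I matters. *)
Record open_system d (Omega : measurableType d) (R : realType) := OpenSystem {
  lo : R;
  hi : R;
  shift : Omega -> Omega;
  unshift : Omega -> Omega;
  fmap : Omega -> R -> R;
  branches : Omega -> set (set R);
  potential : Omega -> R -> R;
  hole : set (Omega * R) }.

Section open_system_theory.
Context {d : measure_display} {Omega : measurableType d} {R : realType}.
Variable S : open_system Omega R.

Local Notation sigma := (shift S).
Local Notation T := (fmap S).

Definition itvI : set R := `[lo S, hi S]%classic.

Fixpoint fmap_iter (n : nat) (w : Omega) (x : R) : R :=
  if n is k.+1 then T (iter k sigma w) (fmap_iter k w x) else x.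

Fixpoint branches_iter (n : nat) (w : Omega) : set (set R) :=
  if n is k.+1 then
    pjoin (branches_iter k w)
      [set itvI `&` fmap_iter k w @^-1` B | B in branches S (iter k sigma w)]
  else [set itvI].

Definition g0 (w : Omega) (x : R) : R := expR (potential S w x).

Definition g0_iter (n : nat) (w : Omega) (x : R) : R :=
  \prod_(j < n) g0 (iter j sigma w) (fmap_iter j w x).

Definition transfer0 (w : Omega) (f : R -> R) (x : R) : R :=
  \sum_(y \in itvI `&` T w @^-1` [set x]) g0 w y * f y.

Definition hole_at (w : Omega) : set R := xsection (hole S) w.

Definition open_itv (w : Omega) : set R := itvI `\` hole_at w.

Definition ind_open (w : Omega) : R -> R := \1_(open_itv w).

Definition survivor (w : Omega) (n : nat) : set R :=
  [set x | itvI x /\ forall j, (j <= n)%N ->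
    ~ hole_at (iter j sigma w) (fmap_iter j w x)].

Definition survivor_oo (w : Omega) : set R := \bigcap_n survivor w n.

(* Used for n >= 1 only, whence the harmless n.-1; the same applies to the
   partitions below. *)
Definition g_iter (n : nat) (w : Omega) (x : R) : R :=
  g0_iter n w x * \1_(survivor w n.-1) x.

Definition transfer (w : Omega) (f : R -> R) : R -> R :=
  transfer0 w (fun x => f x * ind_open w x).

Fixpoint transfer_iter (n : nat) (w : Omega) (f : R -> R) : R -> R :=
  if n is k.+1 then transfer (iter k sigma w) (transfer_iter k w f) else f.

Definition past (n : nat) (w : Omega) : Omega := iter n (unshift S) w.

Definition supportD (w : Omega) (n : nat) : set R :=
  [set x | itvI x /\
    transfer_iter n (past n w) (ind_open (past n w)) x != 0].

(* The sets supportD w n decrease in n only from n = 1 on. *)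
Definition supportD_oo (w : Omega) : set R :=
  \bigcap_(n in [set n | (0 < n)%N]) supportD w n.

Definition Lambda (w : Omega) (f : R -> R) : R :=
  limn (fun n => inf
    [set transfer_iter n w f x / transfer_iter n w (ind_open w) x
       | x in supportD (iter n sigma w) n]).

Definition rho (w : Omega) : R :=
  Lambda (sigma w) (transfer w (ind_open w)).

Definition rho_iter (n : nat) (w : Omega) : R :=
  \prod_(j < n) rho (iter j sigma w).

(* The cutting partition is into intervals: with n = 1 this makes g^(1), hence
   transfer w (ind_open w), of bounded variation, as the definition of rho
   presupposes. *)
Definition admissible_cut (w : Omega) (n : nat) (cut : set (set R)) : Prop :=
  [/\ finite_set cut, interval_partition itvI cut &
    forall A, cut A ->
      (var_on A (g_iter n w) <= 2%:E * sup_norm itvI (g_iter n w))%E].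

Definition adapted (w : Omega) (n : nat) (cut P : set (set R)) : Prop :=
  [/\ interval_partition itvI P, finer P cut, finer P (branches_iter n w) &
    forall A, P A ->
      A `&` survivor w n.-1 = set0 \/ A `<=` survivor w n.-1].

Definition coarsest_adapted (w : Omega) (n : nat) (cut P : set (set R)) : Prop :=
  adapted w n cut P /\ (forall Q, adapted w n cut Q -> finer Q P).

Section Q_objects.
Variable Zhat : Omega -> nat -> set (set R).

Definition Zstar (w : Omega) (n : nat) : set (set R) :=
  [set Z | Zhat w n Z /\ Z `<=` survivor w n.-1].

Definition Zbad (w : Omega) (n : nat) : set (set R) :=
  [set Z | Zstar w n Z /\ Lambda w \1_Z = 0].

Definition Zgood (w : Omega) (n : nat) : set (set R) :=
  [set Z | Zstar w n Z /\ 0 < Lambda w \1_Z].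

Definition holes_upto (w : Omega) (n : nat) : set R :=
  \bigcup_(j in [set j | (j < n)%N])
    (itvI `&` fmap_iter j w @^-1` hole_at (iter j sigma w)).

(* Separation: the points strictly between Z and Z' form exactly one connected
   component of the holes. *)
Definition contiguous (w : Omega) (n : nat) (Z Z' : set R) : Prop :=
  Z <> Z' /\
  (boundary Z `&` boundary Z' !=set0 \/
   exists2 x, holes_upto w n x &
     let C := connected_component (holes_upto w n) x in
     gap Z Z' = C \/ gap Z' Z = C).

(* A family of contiguous bad elements, listed so that neighbours in the list
   are contiguous. *)
Definition bad_run (w : Omega) (n : nat) (s : seq (set R)) : Prop :=
  [/\ uniq s, forall Z, Z \in s -> Zbad w n Z &
    forall i, (i.+1 < size s)%N ->
      contiguous w n (nth set0 s i) (nth set0 s i.+1)].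

Definition xi (w : Omega) (n : nat) : \bar R :=
  ereal_sup [set (size s)%:R%:E | s in bad_run w n].

(* Convention log 0 := 0: if there is no bad element then log xi = 0. *)
Definition log_xi (w : Omega) (n : nat) : \bar R :=
  lne (maxe 1%E (xi w n)).

(* The minimum is taken in \bar R, and is +oo when there is no good element. *)
Definition delta (w : Omega) (n : nat) : \bar R :=
  ereal_inf [set (Lambda w \1_Z)%:E | Z in Zgood w n].

End Q_objects.

Definition log_survival (zeta : set R -> \bar R) (w : Omega) (n : nat) : \bar R :=
  ((n%:R^-1)%:E * lne (zeta (survivor w n)))%E.

Definition lower_escape_rate (zeta : set R -> \bar R) (w : Omega) : \bar R :=
  (- limn_esup (log_survival zeta w))%E.

Definition upper_escape_rate (zeta : set R -> \bar R) (w : Omega) : \bar R :=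
  (- limn_einf (log_survival zeta w))%E.

Definition escape_rate_exists (zeta : set R -> \bar R) (w : Omega) : Prop :=
  lower_escape_rate zeta w = upper_escape_rate zeta w.

(* Meaningful only under escape_rate_exists. *)
Definition escape_rate (zeta : set R -> \bar R) (w : Omega) : \bar R :=
  lower_escape_rate zeta w.

Variable m : probability Omega R.

Record base_system : Prop := {
  lo_lt_hi : lo S < hi S;
  shift_measurable : measurable_fun setT sigma;
  unshift_measurable : measurable_fun setT (unshift S);
  shiftK : cancel sigma (unshift S);
  unshiftK : cancel (unshift S) sigma;
  shift_preserving : forall A, measurable A -> m (sigma @^-1` A) = m A;
  shift_ergodic : forall A, measurable A -> sigma @^-1` A = A ->
    m A = 0%E \/ m A = 1%E;
  fmap_image : forall w, T w @` itvI = itvI;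
  branches_finite : forall w, finite_set (branches S w);
  branches_partition : forall w, interval_partition itvI (branches S w);
  branches_image : forall w Z, branches S w Z -> is_interval (T w @` Z);
  branches_continuous : forall w Z, branches S w Z ->
    {within Z, continuous (T w)};
  branches_monotone : forall w Z, branches S w Z ->
    {in Z &, {homo T w : x y / x < y}} \/
    {in Z &, {homo T w : x y /~ x < y}};
  branches_log_integrable :
    log_integrable m (fun w => (#|` fset_set (branches S w)|%fset)%:R%:E);
  branches_generate : forall w,
    <<s itvI, \bigcup_(n in [set n | (0 < n)%N]) branches_iter n w >> =
    [set A | measurable A /\ A `<=` itvI];
  skew_measurable : measurable_fun (setT `*` itvI)
    (fun p : Omega * R => (sigma p.1, T p.1 p.2)) }.

Record closed_system (nu0 : R.-pker Omega ~> R) (lam0 : Omega -> R)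
    (phi0 : Omega -> R -> R) : Prop := {
  potential_measurable : measurable_fun (setT `*` itvI)
    (fun p : Omega * R => potential S p.1 p.2);
  potential_inf_integrable : m.-integrable setT
    (fun w => ereal_inf [set (potential S w x)%:E | x in itvI]);
  potential_sup_integrable : m.-integrable setT
    (fun w => ereal_sup [set (potential S w x)%:E | x in itvI]);
  g0_BV : {ae m, forall w, BV itvI (g0 w)};
  nu0_itvI : forall w, nu0 w itvI = 1%E;
  nu0_nonatomic : {ae m, forall w, forall x, nu0 w [set x] = 0%E};
  lam0_measurable : measurable_fun setT lam0;
  lam0_neq0 : forall w, lam0 w != 0;
  phi0_BV : BVOmega itvI phi0;
  phi0_gt0 : forall w x, itvI x -> 0 < phi0 w x;
  phi0_eigen : {ae m, forall w, forall x, itvI x ->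
    transfer0 w (phi0 w) x = lam0 w * phi0 (sigma w) x};
  nu0_conformal : {ae m, forall w, forall f, BV itvI f ->
    (\int[nu0 (sigma w)]_(x in itvI) (transfer0 w f x)%:E =
     (lam0 w)%:E * \int[nu0 w]_(x in itvI) (f x)%:E)%E};
  lam0_mass : {ae m, forall w,
    (lam0 w)%:E =
    (\int[nu0 (sigma w)]_(x in itvI) (transfer0 w (cst 1) x)%:E)%E};
  lam0_log_integrable : log_integrable m (fun w => (lam0 w)%:E);
  (* mu0 = phi0 nu0 is a random probability measure, and the corresponding
     measure on Omega x I is invariant under the skew product. *)
  mu0_invariant : exists mu0 : R.-pker Omega ~> R,
    {ae m, forall w, forall A, measurable A ->
      mu0 w A = (\int[nu0 w]_(x in A `&` itvI) (phi0 w x)%:E)%E} /\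
    (forall B : set (Omega * R), measurable B ->
      \int[m]_w mu0 w (itvI `&` [set x | B (sigma w, T w x)]) =
      \int[m]_w mu0 w (itvI `&` [set x | B (w, x)]))%E }.

Record holes (nu0 : R.-pker Omega ~> R) : Prop := {
  hole_measurable : measurable (hole S);
  hole_itvI : hole S `<=` setT `*` itvI;
  hole_mass : (0 < \int[m]_w nu0 w (hole_at w) < 1)%E;
  survivor_oo_neq0 : {ae m, forall w, survivor_oo w !=set0};
  supportD_oo_neq0 : {ae m, forall w, supportD_oo w !=set0} }.

Record Q_assumptions (calA Zhat : Omega -> nat -> set (set R)) : Prop := {
  calA_admissible : {ae m, forall w, forall n, (0 < n)%N ->
    admissible_cut w n (calA w n)};
  Zhat_coarsest : {ae m, forall w, forall n, (0 < n)%N ->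
    coarsest_adapted w n (calA w n) (Zhat w n)};
  Q1 : {ae m, forall w,
    let log_g n := ((n%:R^-1)%:E * lne (sup_norm itvI (g_iter n w)))%E in
    let log_x n := ((n%:R^-1)%:E * log_xi Zhat w n)%E in
    let log_rho n := ((n%:R^-1)%:E * lne (rho_iter n w)%:E)%E in
    [/\ cvgn log_g,
        cvgn log_rho,
        (limn log_g + limn_esup log_x < limn log_rho)%E &
        limn log_rho = (\int[m]_w' lne (rho w')%:E)%E]};
  Q2 : forall n, (0 < n)%N ->
    m.-integrable setT (fun w => log_xi Zhat w n);
  Q3 : forall n, (0 < n)%N -> log_integrable m (fun w => delta Zhat w n) }.

Record associated (nu0 : R.-pker Omega ~> R) (nu : Omega -> probability R R)
    (lam : Omega -> R) (phi : Omega -> R -> R)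
    (eta : Omega -> probability R R) : Prop := {
  (* "Support in survivor_oo w" in the sense of being carried by that set, which
     need not be closed. *)
  nu_survivor_oo : {ae m, forall w, nu w (survivor_oo w) = 1%E};
  nu_Lambda : {ae m, forall w, forall f, BV itvI f ->
    (Lambda w f)%:E = (\int[nu w]_(x in itvI) (f x)%:E)%E};
  lam_rho : {ae m, forall w, lam w = rho w};
  lam_mass : {ae m, forall w,
    (lam w)%:E =
    (\int[nu (sigma w)]_(x in itvI) (transfer w (ind_open w) x)%:E)%E};
  nu_conformal : {ae m, forall w, forall f, BV itvI f ->
    (\int[nu (sigma w)]_(x in itvI) (transfer w f x)%:E =
     (lam w)%:E * \int[nu w]_(x in itvI) (f x)%:E)%E};
  lam_log_integrable : log_integrable m (fun w => (lam w)%:E);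
  phi_BV : BVOmega itvI phi;
  phi_limit : {ae m, forall w,
    {uniform itvI, (fun (n : nat) (x : R) =>
        transfer_iter n (past n w) (ind_open (past n w)) x /
        Lambda w (transfer_iter n (past n w) (ind_open (past n w))))
      @ \oo --> phi w}};
  phi_eigen : {ae m, forall w, forall x, itvI x ->
    transfer w (phi w) x = lam w * phi (sigma w) x};
  phi_mass : {ae m, forall w, (\int[nu w]_(x in itvI) (phi w x)%:E = 1)%E};
  (* eta w being a probability, the denominator cannot vanish. *)
  eta_density : {ae m, forall w, forall A, measurable A ->
    eta w A =
    ((\int[nu0 w]_(x in A `&` itvI) (ind_open w x * phi w x)) /
     (\int[nu0 w]_(x in itvI) (ind_open w x * phi w x)))%:E} }.

Definition expected_pressure (lam : Omega -> R) : \bar R :=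
  (\int[m]_w lne (lam w)%:E)%E.

End open_system_theory.

(* Main.v *)
Require Import Defs.
From mathcomp Require Import ring lra.

(** Write L_w for the open transfer operator, s for the shift and Y_n(w) for the
    set of points of fibre w that avoid the hole at times 0, ..., n-1, and let
    S_n be the Birkhoff sums of the integrable function log (lam0 / lam), called
    [log_ratio]. Conformality of nu0 and of nu turns masses of survivors into
    integrals of iterated operators ([integral_transfer_iter],
    [integral_transfer_iter1]): nu0_w (Y_n(w)) is
    the integral of L_w^n 1 against nu0 over the fibre s^n w, divided by the
    product of the lam0 along the orbit, and Lambda (L_w^n 1) is the product of
    the lam along the orbit. Hence nu0_w (Y_n(w)) exp (S_n w), read on the fibre
    s^n w, is the nu0-integral of the normalised function whose uniform limit is
    phi. With w fixed and the starting fibre s^(-n) w receding into the past it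
    therefore converges to c(w), the nu0_w-integral of phi_w, which is finite and
    positive ([pulled_mass_cvg]). For eta the eigenvalue equation of phi gives the
    identity eta_w (Y_n(w)) = exp (- S_n w) c(s^n w) / D(w), where D(w) does not
    depend on n ([integral_phi_alive]).

    Going forward in n, the error factors sit on the moving fibre s^n w, so that
    convergence for fixed w does not bound them at every time. It bounds them at
    the times n when s^n w visits a set of positive measure on which they stay in
    a compact part of (0, +oo) ([moderate]). By Birkhoff's theorem
    ([birkhoff_ergodic]) such times occur in every window [N, (1 + e) N] with N
    large ([frequent_visits]); and survivor masses decrease in n, so that their
    exponential rate along these times is their rate along all times
    ([rate_along_frequent]). Only an upper bound is used for nu0 and only a lower
    bound for eta: a bounded density makes eta_w at most a constant times nu0_w,
    which supplies the other two. The common rate is the limit of S_n / n, that is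
    the integral of [log_ratio], which is the difference of the pressures.

    Conformality of nu0 and of nu is available against functions of bounded
    variation, so that all functions integrated above must be of that kind. This is handled
    through differences of bounded nondecreasing functions ([jordan]), which are
    visibly stable under the operations needed, in particular under the sums over
    fibres of piecewise monotone maps ([jordan_fibre_sum]). *)

Set Implicit Arguments.
Unset Strict Implicit.
Unset Printing Implicit Defensive.

(** * Birkhoff's theorem for ergodic maps *)

Section ergodic.
Context {d : measure_display} {Omega : measurableType d} {R : realType}.
Variables (m : probability Omega R) (sigma : Omega -> Omega).
Hypothesis sigma_meas : measurable_fun setT sigma.
Hypothesis sigma_pres : forall A, measurable A -> m (sigma @^-1` A) = m A.
Implicit Types f : Omega -> R.

Lemma ae_comp_preserving (P : Omega -> Prop) :
  {ae m, forall w, P w} -> {ae m, forall w, P (sigma w)}.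
Proof.
case=> N [mN N0 PN]; exists (sigma @^-1` N); split.
- by rewrite -[X in measurable X]setTI; exact: sigma_meas.
- by rewrite -[RHS]N0; exact: sigma_pres.
- by move=> w /= Pw; exact: PN.
Qed.

Lemma ae_comp_iter (P : Omega -> Prop) :
  {ae m, forall w, P w} -> {ae m, forall w, forall n, P (iter n sigma w)}.
Proof.
move=> aeP; apply: ae_foralln; elim=> [|n IHn]; first exact: aeP.
by apply: filterS (ae_comp_preserving IHn) => w; rewrite -iterSr.
Qed.

Lemma measurable_comp_sigma f : measurable_fun setT f ->
  measurable_fun setT (f \o sigma).
Proof. by move=> mf; exact: measurableT_comp. Qed.

Lemma integrable_comp_preserving f : measurable_fun setT f ->
  m.-integrable setT (EFin \o f) -> m.-integrable setT (EFin \o (f \o sigma)).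
Proof.
move=> mf /integrableP[_ fi]; apply/integrableP; split.
  exact/measurable_EFinP/measurable_comp_sigma.
apply: le_lt_trans fi; rewrite [leRHS](_ : _ =
    \int[pushforward m sigma]_x `|(EFin \o f) x|)%E.
  rewrite ge0_integral_pushforward//.
  by apply: measurableT_comp => //; exact/measurable_EFinP.
by apply: eq_measure_integral => A mA _; exact/esym/sigma_pres.
Qed.

Lemma integral_comp_preserving f : measurable_fun setT f ->
  m.-integrable setT (EFin \o f) ->
  (\int[m]_w (f (sigma w))%:E = \int[m]_w (f w)%:E)%E.
Proof.
move=> mf fi; rewrite [RHS](_ : _ = \int[pushforward m sigma]_x (EFin \o f) x)%E.
  rewrite (@integral_pushforward _ _ _ _ _ _ sigma_meas m setT (EFin \o f))//.
    exact/measurable_EFinP.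
  exact: integrable_comp_preserving.
by apply: eq_measure_integral => A mA _; exact/esym/sigma_pres.
Qed.

Definition birkhoff_sum f n w : R := \sum_(j < n) f (iter j sigma w).

Lemma birkhoff_sum0 f w : birkhoff_sum f 0 w = 0.
Proof. by rewrite /birkhoff_sum big_ord0. Qed.

Lemma birkhoff_sumS f n w :
  birkhoff_sum f n.+1 w = f w + birkhoff_sum f n (sigma w).
Proof.
rewrite /birkhoff_sum big_ord_recl; congr (_ + _).
by apply: eq_bigr => j _; rewrite /= -iterSr.
Qed.

Lemma measurable_birkhoff_sum f n : measurable_fun setT f ->
  measurable_fun setT (birkhoff_sum f n).
Proof.
move=> mf; elim: n => [|n IHn].
  by rewrite (_ : birkhoff_sum f 0 = cst 0)//; apply/funext => w; exact: birkhoff_sum0.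
rewrite (_ : birkhoff_sum f n.+1 = f \+ (birkhoff_sum f n \o sigma)).
  by apply: measurable_funD => //; exact: measurable_comp_sigma.
by apply/funext => w; exact: birkhoff_sumS.
Qed.

Section maximal.
Variable f : Omega -> R.
Hypothesis mf : measurable_fun setT f.
Hypothesis fi : m.-integrable setT (EFin \o f).

(** The maximum of the Birkhoff sums of orders 0, ..., n at w, in the recursive
    form that compares it with the same maximum at sigma w. *)
Fixpoint birkhoff_max n w : R :=
  if n is k.+1 then Num.max 0 (f w + birkhoff_max k (sigma w)) else 0.

Lemma birkhoff_max_ge0 n w : 0 <= birkhoff_max n w.
Proof. by case: n => [|n] //=; rewrite le_max lexx. Qed.

Lemma birkhoff_sum_le_max n w : birkhoff_sum f n w <= birkhoff_max n w.
Proof.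
elim: n w => [|n IHn] w; first by rewrite birkhoff_sum0.
by rewrite birkhoff_sumS /= le_max lerD2l IHn orbT.
Qed.

Lemma birkhoff_max_leS n w : birkhoff_max n w <= birkhoff_max n.+1 w.
Proof.
elim: n w => [|n IHn] w; first exact: birkhoff_max_ge0.
by rewrite [leRHS]/= ge_max le_max lexx /= le_max lerD2l IHn orbT.
Qed.

Lemma birkhoff_max_nd w : {homo birkhoff_max ^~ w : n k / (n <= k)%N >-> n <= k}.
Proof. by apply: homo_leq => //; [exact: le_trans|move=> n; exact: birkhoff_max_leS]. Qed.

Lemma measurable_birkhoff_max n : measurable_fun setT (birkhoff_max n).
Proof.
elim: n => [|n IHn] //=; apply: measurable_maxr => //.
by apply: measurable_funD => //; exact: measurable_comp_sigma.
Qed.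

Lemma integrable_birkhoff_max n : m.-integrable setT (EFin \o birkhoff_max n).
Proof.
elim: n => [|n IHn]; first exact: integrable0.
have := integrable_comp_preserving (measurable_birkhoff_max n) IHn.
move=> /(integrableD measurableT (integrable_abse fi)); apply: le_integrable => //.
  exact/measurable_EFinP/measurable_birkhoff_max.
move=> w _ /=; rewrite lee_fin [leRHS]ger0_norm; last first.
  by rewrite addr_ge0// birkhoff_max_ge0.
rewrite ger0_norm ?le_max ?lexx// ge_max addr_ge0 ?birkhoff_max_ge0//=.
by rewrite lerD2r ler_norm.
Qed.

Let dif n w := birkhoff_max n.+1 w - birkhoff_max n (sigma w).

Let difE n w : dif n w = Num.max (- birkhoff_max n (sigma w)) (f w).
Proof. by rewrite /dif/= addr_maxl sub0r addrK. Qed.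

Definition unbounded_sums : set Omega :=
  [set w | forall K : nat, exists n, K%:R < birkhoff_max n w].

Lemma measurable_unbounded_sums : measurable unbounded_sums.
Proof.
rewrite (_ : unbounded_sums =
  \bigcap_K \bigcup_n (birkhoff_max n @^-1` `]K%:R, +oo[)).
  apply: bigcapT_measurable => K; apply: bigcupT_measurable => n.
  by rewrite -[X in measurable X]setTI; exact: measurable_birkhoff_max.
apply/seteqP; split=> w /=.
  by move=> wU K _; have [n ?] := wU K; exists n => //=; rewrite in_itv/= andbT.
by move=> wU K; have [n _ /=] := wU K I; rewrite in_itv/= andbT; exists n.
Qed.

Lemma unbounded_sums_real w (K : R) : unbounded_sums w ->
  exists n, K < birkhoff_max n w.
Proof.
move=> /(_ (Num.bound `|K|))[n Kn]; exists n; apply: le_lt_trans Kn.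
by rewrite (le_trans (ler_norm _))// ltW// archi_boundP//.
Qed.

Lemma unbounded_sums_invariant : sigma @^-1` unbounded_sums = unbounded_sums.
Proof.
apply/seteqP; split=> w /= wU K.
  have [n Kn] := unbounded_sums_real (K%:R - f w) wU; exists n.+1 => /=.
  by rewrite lt_max -ltrBlDl Kn orbT.
have [[|n] /=] := unbounded_sums_real (K%:R + `|f w|) wU.
  by rewrite ltNge addr_ge0.
rewrite lt_max ltNge addr_ge0//= => h; exists n.
have := ler_norm (f w); lra.
Qed.

Hypothesis ergodic : forall A, measurable A -> sigma @^-1` A = A ->
  m A = 0%E \/ m A = 1%E.

(** The set where the maxima are unbounded is invariant, hence null or of full
    measure. In the second case the differences
    birkhoff_max n.+1 - birkhoff_max n \o sigma would converge to f, dominated by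
    its absolute value; their integrals being >= 0, by invariance of m and since
    birkhoff_max increases with n, f would have integral >= 0 too. *)
Lemma birkhoff_sum_bounded : (\int[m]_w (f w)%:E < 0)%E ->
  {ae m, forall w, exists K, forall n, birkhoff_sum f n w <= K}.
Proof.
move=> flt0; have mU := measurable_unbounded_sums.
have [U0|U1] := ergodic mU unbounded_sums_invariant.
  exists unbounded_sums; split => // w /= nK K; apply: contrapT => nU.
  apply: nK; exists K%:R => n; rewrite leNgt; apply/negP => Kn; apply: nU.
  by exists n; exact: lt_le_trans Kn (birkhoff_sum_le_max n w).
have mdif n : measurable_fun setT (EFin \o dif n).
  apply/measurable_EFinP/measurable_funB; first exact: measurable_birkhoff_max.
  exact/measurable_comp_sigma/measurable_birkhoff_max.
have aeU : {ae m, forall w, unbounded_sums w}.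
  exists (~` unbounded_sums); split; [exact: measurableC| |by []].
  by rewrite probability_setC// U1 subee.
have dif_ge0 n : (0 <= \int[m]_w (dif n w)%:E)%E.
  rewrite /dif; under eq_integral do rewrite EFinB.
  have iM := integrable_birkhoff_max n.
  have iMS := integrable_birkhoff_max n.+1.
  have iMs := integrable_comp_preserving (measurable_birkhoff_max n) iM.
  rewrite integralB// integral_comp_preserving//; last first.
    exact: measurable_birkhoff_max.
  rewrite sube_ge0; last by rewrite (integrable_fin_num _ iM).
  by apply: le_integral => // w _; rewrite lee_fin birkhoff_max_leS.
have [_ _] : [/\ m.-integrable setT (EFin \o f),
  [sequence \int[m]_w `|(dif n w)%:E - (f w)%:E|]_n @ \oo --> 0 &
  [sequence \int[m]_w (dif n w)%:E]_n @ \oo --> \int[m]_w (f w)%:E]%E.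
  apply: (@dominated_convergence _ _ _ m setT measurableT
    (fun n => EFin \o dif n) (EFin \o f) (abse \o (EFin \o f))) => //.
  - exact: (measurable_int _ fi).
  - apply: filterS aeU => w; rewrite -unbounded_sums_invariant => /= wU _.
    have [N fN] := unbounded_sums_real (- f w) wU.
    apply: cvg_near_cst; exists N => // n /= Nn; congr EFin; rewrite difE.
    apply/max_idPr; rewrite lerNl (le_trans (ltW fN))//.
    exact: birkhoff_max_nd.
  - exact: integrable_abse.
  - apply: aeW => w n _ /=; rewrite lee_fin difE ler_norml.
    have := birkhoff_max_ge0 n (sigma w); have := ler_norm (f w).
    have := ler_norm (- f w); rewrite normrN.
    by case: (leP (- _) (f w)) => ? ? ? ?; apply/andP; split; lra.
move=> dif_cvg; suff : (0 <= \int[m]_w (f w)%:E)%E by rewrite leNgt flt0.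
rewrite -(cvg_lim _ dif_cvg)//; apply: lime_ge; last exact: nearW.
by apply/cvg_ex; eexists; exact: dif_cvg.
Qed.

End maximal.

Section birkhoff.
Hypothesis ergodic : forall A, measurable A -> sigma @^-1` A = A ->
  m A = 0%E \/ m A = 1%E.
Variable f : Omega -> R.
Hypothesis mf : measurable_fun setT f.
Hypothesis fi : m.-integrable setT (EFin \o f).

Lemma birkhoff_sum_upper (a : R) : (\int[m]_w (f w)%:E < a%:E)%E ->
  {ae m, forall w, exists K, forall n, birkhoff_sum f n w <= K + n%:R * a}.
Proof.
move=> fa; pose g w := f w - a.
have ia : m.-integrable setT (EFin \o (cst a : Omega -> R)).
  exact: finite_measure_integrable_cst.
have mg : measurable_fun setT g by exact: measurable_funB.
have ig : m.-integrable setT (EFin \o g) by exact: (integrableB measurableT fi ia).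
have : (\int[m]_w (g w)%:E < 0)%E.
  rewrite /g; under eq_integral do rewrite EFinB.
  rewrite integralB// integral_cst//.
  rewrite [X in (_ - X)%E](_ : _ = a%:E); last first.
    by rewrite -[RHS]mule1; congr (_ * _)%E; exact: probability_setT.
  by rewrite -(fineK (integrable_fin_num measurableT fi)) lte_fin subr_lt0
    -lte_fin (fineK (integrable_fin_num measurableT fi)).
move=> /(birkhoff_sum_bounded mg ig ergodic); apply: filterS => w [K SK].
exists K => n; have := SK n; suff -> : birkhoff_sum g n w =
    birkhoff_sum f n w - n%:R * a by rewrite lerBlDr.
rewrite /birkhoff_sum big_split/= sumr_const card_ord; congr (_ + _).
by rewrite mulNrn mulr_natl.
Qed.
End birkhoff.

(** Almost everywhere the sums of f - a are bounded above, for every a above the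
    mean of f, and those of b - f for every b below it; letting a and b tend to
    the mean squeezes S_n f / n. *)
Theorem birkhoff_ergodic f :
  (forall A, measurable A -> sigma @^-1` A = A -> m A = 0%E \/ m A = 1%E) ->
  measurable_fun setT f -> m.-integrable setT (EFin \o f) ->
  {ae m, forall w, n%:R^-1 * birkhoff_sum f n w @[n --> \oo] -->
    fine (\int[m]_w (f w)%:E)%E}.
Proof.
move=> ergodic mf fi; set a := fine _.
have fa : (\int[m]_w (f w)%:E)%E = a%:E by rewrite fineK// integrable_fin_num.
pose e k : R := k.+1%:R^-1.
have e0 k : 0 < e k by rewrite invr_gt0.
have up : {ae m, forall w k, exists K, forall n,
    birkhoff_sum f n w <= K + n%:R * (a + e k)}.
  apply: ae_foralln => k; apply: birkhoff_sum_upper => //.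
  by rewrite fa lte_fin ltrDl.
have lo : {ae m, forall w k, exists K, forall n,
    birkhoff_sum (\- f) n w <= K + n%:R * (- a + e k)}.
  apply: ae_foralln => k; apply: birkhoff_sum_upper => //.
  - exact: measurable_funN.
  - exact: (integrableN fi).
  under eq_integral do rewrite EFinN.
  rewrite integralN; last first.
    by apply: fin_num_adde_defl; rewrite fin_numN integrable_neg_fin_num.
  by rewrite fa lte_fin ltrDl.
apply: filterS2 up lo => w up lo; apply/cvgrPdist_le => r r0.
have [k] := ltr_add_invr (divr_gt0 r0 (ltr0Sn R 1)); rewrite add0r => kr.
have [K upK] := up k; have [K' loK] := lo k.
exists (Num.bound (2 * (`|K| + `|K'|) / r)).+1 => // n /= Nn.
have n0 : 0 < n%:R :> R by rewrite ltr0n (leq_trans _ Nn).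
have nK : 2 * (`|K| + `|K'|) <= n%:R * r.
  rewrite -ler_pdivrMr//; apply: (le_trans (ltW (archi_boundP _))).
    by rewrite divr_ge0 ?mulr_ge0 ?addr_ge0// ltW.
  by rewrite ler_nat ltnW.
have nk : n%:R * e k <= n%:R * (r / 2) by rewrite ler_pM2l// ltW.
have := upK n; have := loK n; have := ler_norm K; have := ler_norm K'.
have -> : birkhoff_sum (\- f) n w = - birkhoff_sum f n w.
  by rewrite /birkhoff_sum sumrN.
have nS : n%:R * (a - n%:R^-1 * birkhoff_sum f n w) =
    n%:R * a - birkhoff_sum f n w by field; rewrite gt_eqF.
move=> ? ? ? ?; suff : `|n%:R * (a - n%:R^-1 * birkhoff_sum f n w)| <= n%:R * r.
  by rewrite normrM gtr0_norm// ler_pM2l.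
rewrite nS ler_norml.
have := normr_ge0 K; have := normr_ge0 K'.
by move=> ? ?; apply/andP; split; lra.
Qed.

End ergodic.

(** * Exponential rates of monotone sequences along frequent times *)

Section rates.
Context {R : realType}.
Implicit Types (H : set nat) (u v s : nat -> R).

(** What the growth argument retains of the positive density of a set of times. *)
Definition frequent H : Prop := forall e : R, 0 < e -> exists N0 : nat,
  forall N, (N0 <= N)%N -> exists n, [/\ H n, (N <= n)%N &
    n%:R <= (1 + e) * N%:R].

Lemma near_infty_nat_mul (r : R) : 0 < r -> forall C : R,
  exists N0, forall N, (N0 <= N)%N -> C <= N%:R * r.
Proof.
move=> r0 C; exists (Num.bound (`|C| / r)) => N N0N.
rewrite -ler_pdivrMr//; apply: (@le_trans _ _ (`|C| / r)).
  by rewrite ler_pM2r ?invr_gt0// ler_norm.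
apply: (le_trans (ltW (archi_boundP _))); first by rewrite divr_ge0// ltW.
by rewrite ler_nat.
Qed.

Lemma frequent_backward H : frequent H -> forall e : R, 0 < e -> forall N1 : nat,
  exists N0 : nat, forall N, (N0 <= N)%N -> exists n,
    [/\ H n, (N1 <= n)%N, (n <= N)%N & N%:R <= (1 + e) * n%:R].
Proof.
move=> fH e e0 N1; have e20 : 0 < e / 2 by rewrite divr_gt0.
have [N2 hN2] := fH _ e20; have [N3 hN3] := near_infty_nat_mul e20 (1 + e / 2).
pose N4 := maxn N1 (maxn N2 N3).
have [N0 hN0] := @near_infty_nat_mul (1 + e / 2)^-1 ltac:(by rewrite invr_gt0 addr_gt0)
  (N4.+1)%:R.
(* A time of H at most (1 + e / 2) times as large as M := N / (1 + e / 2), rounded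
   down, is at most N; the rest of e pays for the rounding. *)
exists N0 => N N0N; pose y : R := N%:R / (1 + e / 2).
have e1 : 0 < 1 + e / 2 by rewrite addr_gt0.
have y0 : 0 <= y by rewrite divr_ge0// ltW.
have /andP[My yM] := truncn_itv y0; set M := Num.truncn y in My yM.
have N4M : (N4 <= M)%N.
  rewrite -ltnS -(ltr_nat R) (lt_le_trans _ (ltW yM))//.
  by rewrite (lt_le_trans _ (hN0 _ N0N))// ltr_nat.
move: (N4M); rewrite /N4 !geq_max => /and3P[N1M N2M N3M].
have [n [Hn Mn nM]] := hN2 _ N2M; exists n; split => //.
- exact: leq_trans Mn.
- rewrite -(ler_nat R) (le_trans nM)//.
  by move: My; rewrite /y ler_pdivlMr// mulrC.
- have := hN3 n (leq_trans N3M Mn).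
  move: yM; rewrite /y ltr_pdivrMr// -natr1 => yM.
  have : (1 + e / 2) * M%:R <= (1 + e / 2) * n%:R by rewrite ler_pM2l// ler_nat.
  lra.
Qed.

Lemma cvg_rateP u (a : R) : (forall r, 0 < r -> exists N0, forall N, (N0 <= N)%N ->
    `|u N - N%:R * a| <= N%:R * r) <->
  n%:R^-1 * u n @[n --> \oo] --> a.
Proof.
have nE n x : (0 < n)%N -> n%:R * (n%:R^-1 * x) = x :> R.
  by move=> n0; rewrite mulrA divff ?mul1r// pnatr_eq0 -lt0n.
split=> [ua|/cvgrPdist_le ua r r0].
  apply/cvgrPdist_le => r r0; have [N0 hN0] := ua _ r0.
  exists N0.+1 => // n /= N0n; have n0 : (0 < n)%N by rewrite (leq_trans _ N0n).
  rewrite -(@ler_pM2l _ n%:R) ?ltr0n//.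
  have := hN0 n (ltnW N0n); apply: le_trans.
  rewrite -{1}[n%:R]ger0_norm// -normrM mulrBr nE// distrC.
  by rewrite lexx.
have [N0 _ hN0] := ua _ r0; exists N0.+1 => n N0n.
have n0 : (0 < n)%N by rewrite (leq_trans _ N0n).
have := hN0 n (ltnW N0n); rewrite -(@ler_pM2l _ n%:R) ?ltr0n//.
by rewrite -{1}[n%:R]ger0_norm// -normrM mulrBr nE// distrC.
Qed.

(** Monotonicity carries the rate from the times in H to all times: for N large,
    some n in H satisfies N <= n <= (1 + e) N, another n <= N <= (1 + e) n. *)
Lemma rate_along_frequent u v s (a C : R) H : frequent H -> 0 <= C ->
  (forall n k, (n <= k)%N -> u k <= u n) ->
  (forall n k, (n <= k)%N -> v k <= v n) ->
  (forall n, v n <= u n + C) ->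
  (forall n, H n -> u n <= s n + C) ->
  (forall n, H n -> s n - C <= v n) ->
  n%:R^-1 * s n @[n --> \oo] --> a ->
  n%:R^-1 * u n @[n --> \oo] --> a /\ n%:R^-1 * v n @[n --> \oo] --> a.
Proof.
move=> fH C0 und vnd vu us sv /cvg_rateP sa.
suff main r : 0 < r -> exists N0, forall N, (N0 <= N)%N ->
    N%:R * a - N%:R * r <= v N - C /\ u N + C <= N%:R * a + N%:R * r.
  split; apply/cvg_rateP => r r0; have [N0 hN0] := main _ r0; exists N0 => N N0N;
  have [] := hN0 _ N0N; have := vu N; rewrite ler_norml => ? ? ?;
  by apply/andP; split; lra.
move=> r0; pose e := Num.min 1 (r / (2 * (`|a| + 3))).
have a3 : 0 < 2 * (`|a| + 3) by rewrite mulr_gt0// ltr_wpDl.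
have e0 : 0 < e by rewrite lt_min ltr01 divr_gt0.
have e1 : e <= 1 by rewrite ge_min lexx.
have er : (`|a| + 3) * e <= r / 2.
  have : e <= r / (2 * (`|a| + 3)) by rewrite ge_min lexx orbT.
  rewrite ler_pdivlMr//; lra.
have r20 : 0 < r / 2 by rewrite divr_gt0.
have [N1 hN1] := sa _ e0.
have [N2 hN2] := near_infty_nat_mul r20 (2 * C).
have [N3 hN3] := fH _ e0.
have [N4 hN4] := frequent_backward fH e0 N1.
exists (maxn (maxn N1 N2) (maxn N3 N4)) => N.
rewrite !geq_max => /andP[/andP[N1N N2N] /andP[N3N N4N]].
have CN := hN2 _ N2N.
have erN : N%:R * ((`|a| + 3) * e) <= N%:R * (r / 2) by rewrite ler_wpM2l.
have dist n k : (n <= k)%N -> k%:R <= (1 + e) * n%:R ->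
    `|n%:R * a - k%:R * a| <= n%:R * (`|a| * e).
  move=> nk kn; rewrite -mulrBl normrM distrC (@ger0_norm _ (k%:R - _)) ?subr_ge0 ?ler_nat//.
  rewrite [leRHS](_ : _ = e * n%:R * `|a|); last by ring.
  by rewrite ler_wpM2r//; lra.
split.
  have [n [Hn Nn nN]] := hN3 _ N3N.
  have := hN1 _ (leq_trans N1N Nn); have := dist _ _ Nn nN.
  have := vnd _ _ Nn; have := sv _ Hn; rewrite !ler_norml => ? ? /andP[? ?] /andP[? ?].
  have : n%:R * e <= 2 * N%:R * e by rewrite ler_wpM2r ?(ltW e0)//; nra.
  nra.
have [n [Hn N1n nN Nn]] := hN4 _ N4N.
have := hN1 _ N1n; have := dist _ _ nN Nn.
have := und _ _ nN; have := us _ Hn; rewrite !ler_norml => ? ? /andP[? ?] /andP[? ?].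
have nNR : n%:R <= N%:R :> R by rewrite ler_nat.
have : n%:R * e <= N%:R * e by rewrite ler_wpM2r// ltW.
have : n%:R * (`|a| * e) <= N%:R * (`|a| * e) by rewrite ler_wpM2r// mulr_ge0// ltW.
nra.
Qed.

(** Without a time of H in the window from N to (1 + e) N the number of such times
    would be the same at both ends, against its linear growth. *)
Lemma density_frequent H (b : R) : 0 < b ->
  n%:R^-1 * (\sum_(j < n) \1_H (j : nat)) @[n --> \oo] --> b -> frequent H.
Proof.
move=> b0 /cvg_rateP Hb e; wlog e1 : e / e <= 1.
  move=> wl e0; have e'0 : 0 < Num.min 1 e by rewrite lt_min ltr01.
  have [|N0 hN0] := wl (Num.min 1 e) _ e'0; first by rewrite ge_min lexx.
  exists N0 => N /hN0[n [Hn Nn nN]]; exists n; split => //; apply: (le_trans nN).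
  by rewrite ler_wpM2r// lerD2l ge_min lexx orbT.
move=> e0; pose c := b * e / 4.
have c0 : 0 < c by rewrite divr_gt0// mulr_gt0.
have [N0 hN0] := Hb _ c0; exists N0.+1 => N N0N; apply: contrapT => noH.
have y0 : 0 <= (1 + e) * N%:R by rewrite mulr_ge0// addr_ge0// ltW.
have /andP[My yM] := truncn_itv y0; set M := Num.truncn _ in My yM.
have NM : (N <= M.+1)%N.
  by rewrite -(ler_nat R) (le_trans _ (ltW yM))//; nra.
have sumE : \sum_(j < M.+1) \1_H (j : nat) = \sum_(j < N) \1_H (j : nat) :> R.
  rewrite -!(big_mkord xpredT (fun j => \1_H j : R)) (big_cat_nat (n := N))//=.
  rewrite [X in _ + X]big_nat_cond [X in _ + X]big1 ?addr0// => j.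
  rewrite andbT ltnS => /andP[Nj jM]; rewrite indicE memNset// => Hj; apply: noH.
  by exists j; split => //; rewrite (le_trans _ My)// ler_nat.
have := hN0 N (ltnW N0N); have := hN0 M.+1 (leq_trans (ltnW N0N) NM).
rewrite sumE !ler_norml => /andP[h1 _] /andP[_ h2].
have N00 : 0 < N%:R :> R by rewrite ltr0n (leq_trans _ N0N).
have bc : 0 <= b - c by rewrite /c; nra.
have : (1 + e) * N%:R * (b - c) <= M.+1%:R * (b - c) by rewrite ler_wpM2r// ltW.
have be0 : 0 < b * e by rewrite mulr_gt0.
have : 0 <= b * e * (1 - e) by rewrite mulr_ge0 ?subr_ge0// ltW.
have : (b + c) < (1 + e) * (b - c) by rewrite /c; nra.
nra.
Qed.
End rates.

Lemma frequent_visits d (Omega : measurableType d) (R : realType)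
    (m : probability Omega R) (sigma : Omega -> Omega) (B : set Omega) :
  measurable_fun setT sigma ->
  (forall A, measurable A -> m (sigma @^-1` A) = m A) ->
  (forall A, measurable A -> sigma @^-1` A = A -> m A = 0%E \/ m A = 1%E) ->
  measurable B -> (0 < m B)%E ->
  {ae m, forall w, @frequent R [set n | B (iter n sigma w)]}.
Proof.
move=> ms pres erg mB B0.
have mf : measurable_fun setT (\1_B : Omega -> R) by exact: measurable_indic.
have iB : m.-integrable setT (EFin \o (\1_B : Omega -> R)).
  exact: integrable_indic.
apply: filterS (birkhoff_ergodic ms pres erg mf iB) => w.
rewrite integral_indic// setIT => h.
apply: density_frequent h; apply: fine_gt0.
by rewrite B0 -ge0_fin_numE// fin_num_measure.
Qed.

(** * Bounded variation as difference of monotone functions *)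

Section bounded_variation.
Context {R : realType}.
Implicit Types (A B I Z : set R) (f g p q T : R -> R).

Definition nondec_on A p : Prop :=
  forall x y, A x -> A y -> x <= y -> p x <= p y.

(** Both monotone parts are normalised to take their values in one interval
    [0, M]: nonnegative parts make products manageable, and a common upper bound
    lets both be continued beyond A. *)
Definition jordan A f : Prop := exists p q (M : R),
  [/\ nondec_on A p, nondec_on A q,
      forall x, A x -> 0 <= p x <= M, forall x, A x -> 0 <= q x <= M &
      forall x, A x -> f x = p x - q x].

Lemma jordanS A B f : B `<=` A -> jordan A f -> jordan B f.
Proof.
move=> BA [p [q [M [pnd qnd pM qM fE]]]]; exists p, q, M; split.
- by move=> x y Bx By; apply: pnd; exact: BA.
- by move=> x y Bx By; apply: qnd; exact: BA.
- by move=> x /BA; exact: pM.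
- by move=> x /BA; exact: qM.
- by move=> x /BA; exact: fE.
Qed.

Lemma eq_jordan A f g : (forall x, A x -> f x = g x) -> jordan A f -> jordan A g.
Proof.
move=> fg [p [q [M [pnd qnd pM qM fE]]]]; exists p, q, M; split => //.
by move=> x Ax; rewrite -fg// fE.
Qed.

Lemma jordan_diff A p q (M : R) : nondec_on A p -> nondec_on A q ->
  (forall x, A x -> `|p x| <= M) -> (forall x, A x -> `|q x| <= M) ->
  jordan A (fun x => p x - q x).
Proof.
move=> pnd qnd pM qM; exists (fun x => p x + M), (fun x => q x + M), (2 * M).
split.
- by move=> x y Ax Ay xy; rewrite lerD2r pnd.
- by move=> x y Ax Ay xy; rewrite lerD2r qnd.
- by move=> x /pM; rewrite ler_norml => /andP[? ?]; apply/andP; split; lra.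
- by move=> x /qM; rewrite ler_norml => /andP[? ?]; apply/andP; split; lra.
- by move=> x _; ring.
Qed.

Lemma jordan_bounded A f : jordan A f ->
  exists2 M : R, 0 <= M & forall x, A x -> `|f x| <= M.
Proof.
move=> [p [q [M [_ _ pM qM fE]]]]; exists `|M|; first exact: normr_ge0.
move=> x Ax; rewrite fE// ler_norml.
have /andP[? ?] := pM _ Ax; have /andP[? ?] := qM _ Ax.
by have := ler_norm M => ?; apply/andP; split; lra.
Qed.

Lemma jordan_nondec A p (M : R) : nondec_on A p ->
  (forall x, A x -> `|p x| <= M) -> jordan A p.
Proof.
move=> pnd pM; apply: (@eq_jordan A (fun x => p x - 0)) => [x _|].
  by rewrite subr0.
apply: (jordan_diff pnd _ pM) => // x Ax.
by rewrite normr0 (le_trans _ (pM _ Ax)).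
Qed.

Lemma jordan_cst A (c : R) : jordan A (fun=> c).
Proof. exact: (@jordan_nondec _ _ `|c|). Qed.

Lemma jordanD A f g : jordan A f -> jordan A g -> jordan A (fun x => f x + g x).
Proof.
move=> [p [q [M [pnd qnd pM qM fE]]]] [p' [q' [M' [pnd' qnd' pM' qM' gE]]]].
exists (fun x => p x + p' x), (fun x => q x + q' x), (M + M'); split.
- by move=> x y Ax Ay xy; rewrite lerD ?pnd ?pnd'.
- by move=> x y Ax Ay xy; rewrite lerD ?qnd ?qnd'.
- move=> x Ax; have /andP[? ?] := pM _ Ax; have /andP[? ?] := pM' _ Ax.
  by apply/andP; split; lra.
- move=> x Ax; have /andP[? ?] := qM _ Ax; have /andP[? ?] := qM' _ Ax.
  by apply/andP; split; lra.
- by move=> x Ax; rewrite fE// gE//; ring.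
Qed.

Lemma jordan_sum A (J : Type) (r : seq J) (F : J -> R -> R) :
  (forall j, jordan A (F j)) -> jordan A (fun x => \sum_(j <- r) F j x).
Proof.
move=> FA; elim: r => [|j r IHr].
  apply: (@eq_jordan A (fun=> 0)) => [x _|]; first by rewrite big_nil.
  exact: jordan_cst.
apply: (@eq_jordan A (fun x => F j x + \sum_(i <- r) F i x)) => [x _|].
  by rewrite big_cons.
exact: jordanD.
Qed.

Lemma jordanM A f g : jordan A f -> jordan A g -> jordan A (fun x => f x * g x).
Proof.
move=> [p [q [M [pnd qnd pM qM fE]]]] [p' [q' [M' [pnd' qnd' pM' qM' gE]]]].
have M0 x : A x -> 0 <= M.
  by move=> Ax; have /andP[? ?] := pM _ Ax; lra.
have prod_nd (a b : R -> R) : nondec_on A a -> nondec_on A b ->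
    (forall x, A x -> 0 <= a x) -> (forall x, A x -> 0 <= b x) ->
    nondec_on A (fun x => a x * b x).
  move=> and_ bnd a0 b0 x y Ax Ay xy.
  by rewrite ler_pM ?a0 ?b0 ?and_ ?bnd.
have ge0 (a : R -> R) (K : R) : (forall x, A x -> 0 <= a x <= K) ->
    forall x, A x -> 0 <= a x by move=> aK x /aK /andP[].
have p0 := ge0 _ _ pM; have q0 := ge0 _ _ qM.
have p0' := ge0 _ _ pM'; have q0' := ge0 _ _ qM'.
exists (fun x => p x * p' x + q x * q' x), (fun x => p x * q' x + q x * p' x),
  (2 * (M * M')).
have bnd (a b : R -> R) : (forall x, A x -> 0 <= a x <= M) ->
    (forall x, A x -> 0 <= b x <= M') ->
    forall x, A x -> 0 <= a x * b x <= M * M'.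
  move=> aM bM x Ax; have /andP[? ?] := aM _ Ax; have /andP[? ?] := bM _ Ax.
  by rewrite mulr_ge0//= ler_pM.
split.
- by move=> x y Ax Ay xy; rewrite lerD// prod_nd.
- by move=> x y Ax Ay xy; rewrite lerD// prod_nd.
- move=> x Ax; have /andP[? ?] := bnd _ _ pM pM' _ Ax.
  by have /andP[? ?] := bnd _ _ qM qM' _ Ax; apply/andP; split; lra.
- move=> x Ax; have /andP[? ?] := bnd _ _ pM qM' _ Ax.
  by have /andP[? ?] := bnd _ _ qM pM' _ Ax; apply/andP; split; lra.
- by move=> x Ax; rewrite fE// gE//; ring.
Qed.

(** The hypotheses say that f + p is nondecreasing, and f = (f + p) - p. *)
Lemma jordan_control A f p (M : R) : nondec_on A p ->
  (forall x, A x -> `|p x| <= M) -> (forall x, A x -> `|f x| <= M) ->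
  (forall x y, A x -> A y -> x <= y -> `|f y - f x| <= p y - p x) ->
  jordan A f.
Proof.
move=> pnd pM fM fp.
apply: (@eq_jordan A (fun x => (f x + p x) - p x)) => [x _|]; first by ring.
apply: (@jordan_diff A (fun x => f x + p x) p (2 * M)) => //.
- move=> x y Ax Ay xy; have := fp _ _ Ax Ay xy; rewrite ler_norml => /andP[? ?].
  lra.
- move=> x Ax; rewrite (le_trans (ler_normD _ _))// mulr_natl mulr2n.
  by rewrite lerD ?fM ?pM.
- move=> x Ax; have := pM _ Ax; have := normr_ge0 (p x); lra.
Qed.

Lemma jordanV A f (c : R) : 0 < c -> (forall x, A x -> c <= f x) ->
  jordan A f -> jordan A (fun x => (f x)^-1).
Proof.
move=> c0 cf [p [q [M [pnd qnd pM qM fE]]]].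
have f0 x : A x -> 0 < f x by move=> /cf; exact: lt_le_trans.
have c20 : 0 <= c ^- 2 by rewrite invr_ge0 exprn_ge0// ltW.
apply: (@jordan_control A _ (fun x => c ^- 2 * (p x + q x))
  (Num.max c^-1 (c ^- 2 * (2 * M)))).
- by move=> x y Ax Ay xy; rewrite ler_wpM2l// lerD ?pnd ?qnd.
- move=> x Ax; have /andP[? ?] := pM _ Ax; have /andP[? ?] := qM _ Ax.
  rewrite ger0_norm ?mulr_ge0 ?addr_ge0// le_max; apply/orP; right.
  by rewrite ler_wpM2l//; lra.
- move=> x Ax; have fx := f0 _ Ax; rewrite gtr0_norm ?invr_gt0// le_max; apply/orP; left.
  by rewrite lef_pV2 ?posrE// cf.
- move=> x y Ax Ay xy; have := f0 _ Ax; have := f0 _ Ay => fy fx.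
  rewrite -mulrBr [X in `|X|](_ : _ = (f x * f y)^-1 * (f x - f y)); last first.
    by field; rewrite !gt_eqF.
  have fxy : 0 < (f x * f y)^-1 by rewrite invr_gt0 mulr_gt0.
  rewrite normrM gtr0_norm//; apply: ler_pM => //; first exact: ltW.
    rewrite lef_pV2 ?posrE ?mulr_gt0// expr2.
    by apply: ler_pM; [exact: ltW|exact: ltW|exact: cf|exact: cf].
  rewrite !fE// ler_norml; have := pnd _ _ Ax Ay xy; have := qnd _ _ Ax Ay xy.
  by move=> ? ?; apply/andP; split; lra.
Qed.

Definition monotone_on A T : Prop :=
  (forall x y, A x -> A y -> x <= y -> T x <= T y) \/
  (forall x y, A x -> A y -> x <= y -> T y <= T x).

Lemma jordan_comp A B f T : monotone_on A T -> (forall x, A x -> B (T x)) ->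
  jordan B f -> jordan A (f \o T).
Proof.
move=> [Tnd|Tni] AB [p [q [M [pnd qnd pM qM fE]]]].
  exists (p \o T), (q \o T), M; split.
  - by move=> x y Ax Ay xy /=; apply: pnd; auto.
  - by move=> x y Ax Ay xy /=; apply: qnd; auto.
  - by move=> x Ax /=; apply: pM; auto.
  - by move=> x Ax /=; apply: qM; auto.
  - by move=> x Ax /=; apply: fE; auto.
exists (fun x => M - q (T x)), (fun x => M - p (T x)), M; split.
- by move=> x y Ax Ay xy /=; rewrite lerD2l lerN2 qnd//; auto.
- by move=> x y Ax Ay xy /=; rewrite lerD2l lerN2 pnd//; auto.
- by move=> x /AB/qM /andP[? ?]; apply/andP; split; lra.
- by move=> x /AB/pM /andP[? ?]; apply/andP; split; lra.
- by move=> x /AB/fE /= ->; ring.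
Qed.

(** Above A both monotone parts are continued by the same constant, which
    cancels in the difference; below A they vanish. *)
Lemma jordan_patch A f : is_interval A -> jordan A f -> jordan setT (f \_ A).
Proof.
move=> iA [p [q [M [pnd qnd pM qM fE]]]].
have [A0|/negP/negP/set0P[a Aa]] := boolP `[< A = set0 >].
  apply: (@eq_jordan _ (fun=> 0)); last exact: jordan_cst.
  by move=> x _; rewrite patchE memNset// (asboolW A0).
have M0 : 0 <= M by have /andP[? ?] := pM _ Aa; lra.
pose up : set R := [set x | forall y, A y -> y < x].
pose ext (r : R -> R) (x : R) := if x \in A then r x else if x \in up then M else 0.
have extnd r : nondec_on A r -> (forall x, A x -> 0 <= r x <= M) ->
    nondec_on setT (ext r).
  move=> rnd rM x y _ _ xy; rewrite /ext.
  have [/set_mem Ax|/negP nAx] := boolP (x \in A).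
    have [/set_mem Ay|/negP nAy] := boolP (y \in A); first exact: rnd.
    rewrite mem_set; first by have /andP[] := rM _ Ax.
    move=> z Az; rewrite ltNge; apply/negP => yz; apply: nAy; apply/mem_set.
    by apply: (iA x z) => //; rewrite xy.
  have [/set_mem upx|/negP nupx] := boolP (x \in up).
    rewrite ifF; last first.
      by apply/negP => /set_mem/upx; rewrite ltNge xy.
    by rewrite mem_set// => z /upx zx; exact: lt_le_trans xy.
  case: ifPn => [/set_mem Ay|_]; first by have /andP[] := rM _ Ay.
  by case: ifP.
have extM r : (forall x, A x -> 0 <= r x <= M) -> forall x, setT x -> 0 <= ext r x <= M.
  move=> rM x _; rewrite /ext; case: ifPn => [/set_mem/rM//|_].
  by case: ifPn; rewrite ?lexx ?M0.
exists (ext p), (ext q), M; split; [exact: extnd|exact: extnd|exact: extM|exact: extM|].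
move=> x _; rewrite patchE /ext; case: ifPn => [/set_mem/fE//|_].
by rewrite subrr.
Qed.

Lemma jordan_measurable A f : measurable A -> is_interval A -> jordan A f ->
  measurable_fun A f.
Proof.
move=> mA iA /(jordan_patch iA)[p [q [M [pnd qnd _ _ fE]]]].
apply: (@eq_measurable_fun _ _ _ _ A (fun x => p x - q x)).
  by move=> x Ax; rewrite -fE// patchE Ax.
apply: measurable_funB; apply: nondecreasing_measurable => // x y xy.
  exact: pnd.
exact: qnd.
Qed.

Lemma variation_control A f p x y s :
  (forall x y, A x -> A y -> x <= y -> `|f y - f x| <= p y - p x) ->
  itv_partition x y s -> (forall z, z \in x :: s -> A z) ->
  variation x y f s <= p y - p x.
Proof.
move=> fp; elim: s x => [|h t IHt] x xy sA.
  by rewrite variation_nil (itv_partition_nil xy) subrr.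
have hy := itv_partition_cons xy; have /= := xy => -[/andP[xh _] _].
rewrite -cat1s (@variation_cat _ h)//; last exact: itv_partition1.
- have -> : p y - p x = (p h - p x) + (p y - p h) by ring.
  apply: lerD; last by apply: IHt => // z zt; apply: sA; rewrite inE zt orbT.
  rewrite /variation/= big_nat1/=; apply: fp; last exact: ltW.
    by apply: sA; rewrite mem_head.
  by apply: sA; rewrite !inE eqxx orbT.
- exact: ltW.
- exact: itv_partition_le hy.
Qed.

Lemma jordan_BV A f : jordan A f -> BV A f.
Proof.
move=> fJ; split.
  have [M _ fM] := jordan_bounded fJ.
  apply: (@le_lt_trans _ _ M%:E); last exact: ltry.
  by apply: ge_ereal_sup => _ [x Ax <-]; rewrite lee_fin fM.
have [p [q [M [pnd qnd pM qM fE]]]] := fJ.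
apply: (@le_lt_trans _ _ (2 * M)%:E); last exact: ltry.
apply: ge_ereal_sup => _ [x [y [s [xy sA ->]]]]; rewrite lee_fin.
have Ax : A x by apply: sA; rewrite mem_head.
have Ay : A y by apply: sA; case: xy => _ /eqP <-; exact: mem_last.
apply: (@le_trans _ _ ((p y + q y) - (p x + q x))).
  apply: (@variation_control A f (fun x => p x + q x)) => // u v Au Av uv.
  rewrite !fE// ler_norml; have := pnd _ _ Au Av uv; have := qnd _ _ Au Av uv.
  by move=> ? ?; apply/andP; split; lra.
have /andP[? ?] := pM _ Ax; have /andP[? ?] := qM _ Ax.
have /andP[? ?] := pM _ Ay; have /andP[? ?] := qM _ Ay; lra.
Qed.

Lemma var_on_ge0 A f x : A x -> (0 <= var_on A f)%E.
Proof.
move=> Ax; apply: ereal_sup_ubound; exists x, x, [::]; split => //.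
- by move=> z; rewrite inE => /eqP ->.
- by rewrite variation_nil.
Qed.

(** A chain in A ending at or before x extends by x and y; the last step costs at
    least the increment of f from x to y. *)
Lemma var_on_step A f x y : A x -> A y -> x < y ->
  (var_on (A `&` [set z | (z <= x)%R]) f + `|f y - f x|%:E <=
   var_on (A `&` [set z | (z <= y)%R]) f)%E.
Proof.
move=> Ax Ay xy; rewrite -leeBrDr//; apply: ge_ereal_sup.
move=> _ [a [b [s [ab sA ->]]]]; rewrite leeBrDr// -EFinD.
have [Ab bx] : A b /\ b <= x.
  by case: ab => _ /eqP <-; exact: sA (mem_last _ _).
pose t := if b == x then [:: y] else [:: x; y].
have bt : itv_partition b y t.
  rewrite /t; case: eqVneq => [->|nbx]; first exact: itv_partition1.
  by split => //=; rewrite xy lt_neqAle nbx bx.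
have ay := itv_partition_cat ab bt.
apply: (@le_trans _ _ (variation a y f (s ++ t))%:E); last first.
  apply: ereal_sup_ubound; exists a, y, (s ++ t); split => // z.
  rewrite -cat_cons mem_cat => /orP[/sA[Az zx]|].
    by split => //=; exact: le_trans zx (ltW xy).
  rewrite /t; case: eqVneq => [_|_]; rewrite !inE.
    by move=> /eqP ->; split => /=.
  by move=> /orP[] /eqP ->; split => //=; exact: ltW.
rewrite lee_fin (@variation_cat _ b)//; last 2 first.
- exact: itv_partition_le ab.
- exact: itv_partition_le bt.
rewrite lerD2l /t; case: eqVneq => [->|_].
  by rewrite /variation/= big_nat1.
by rewrite /variation/= big_nat_recl//= big_nat1/= lerDr.
Qed.

(** The variation of f over the part of A to the left of x, as a function of x,
    controls the increments of f. *)
Lemma BV_jordan A f : BV A f -> jordan A f.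
Proof.
move=> [supf varf].
pose V x := var_on (A `&` [set z | (z <= x)%R]) f.
have V0 x : A x -> (0 <= V x)%E by move=> Ax; apply: (@var_on_ge0 _ _ x); split => /=.
have VA x : (V x <= var_on A f)%E.
  apply: ge_ereal_sup => _ [a [b [s [ab sA ->]]]].
  by apply: ereal_sup_ubound; exists a, b, s; split => // z /sA[].
have Vfin x : A x -> V x \is a fin_num.
  by move=> Ax; rewrite ge0_fin_numE ?V0// (le_lt_trans (VA x)).
have fsup x : A x -> (`|f x|%:E <= sup_norm A f)%E.
  by move=> Ax; apply: ereal_sup_ubound; exists x.
have fM x : A x -> `|f x| <= fine (sup_norm A f).
  move=> Ax; rewrite -lee_fin fineK ?fsup// ge0_fin_numE//.
  exact: le_trans (fsup _ Ax).
have fV x y : A x -> A y -> x <= y -> `|f y - f x| <= fine (V y) - fine (V x).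
  move=> Ax Ay; rewrite le_eqVlt => /predU1P[->|xy]; first by rewrite !subrr normr0.
  rewrite lerBrDl -lee_fin EFinD !fineK ?Vfin//; exact: var_on_step.
apply: (@jordan_control _ _ (fine \o V)
    (Num.max (fine (sup_norm A f)) (fine (var_on A f)))) => //.
- move=> x y Ax Ay xy /=; rewrite -subr_ge0; exact: le_trans (fV _ _ Ax Ay xy).
- move=> x Ax /=; rewrite ger0_norm ?fine_ge0 ?V0// le_max; apply/orP; right.
  rewrite fine_le ?Vfin// ge0_fin_numE//; exact: var_on_ge0 Ax.
- by move=> x Ax; rewrite le_max fM.
Qed.

Lemma BVP A f : BV A f <-> jordan A f.
Proof. by split; [exact: BV_jordan|exact: jordan_BV]. Qed.

End bounded_variation.

Section piecewise_monotone.
Context {R : realType}.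
Variables (I : set R) (P : set (set R)).
Hypotheses (finP : finite_set P) (partP : interval_partition I P).
Implicit Types (f g u T : R -> R) (Z : set R).

Let PI Z : P Z -> Z `<=` I.
Proof. by move=> PZ; case: partP => -[<- _ _] _; exact: bigcup_sup. Qed.

Lemma piece_sum f x : I x ->
  \sum_(Z <- fset_set P) (f \_ Z) x = f x.
Proof.
case: partP => -[covP trivP _] _; rewrite -{1}covP => -[Z PZ Zx].
have ZP : Z \in fset_set P by rewrite in_fset_set// mem_set.
rewrite (bigD1_seq Z) ?fset_uniq//= patchE mem_set// big_seq_cond big1 ?addr0// => Y.
rewrite in_fset_set// => /andP[/set_mem PY YZ]; rewrite patchE memNset// => Yx.
by case/eqP: YZ; apply: trivP => //; exists x.
Qed.

(** Extended by 0, the restriction of f to a piece is still a difference of bounded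
    nondecreasing functions on the whole line, because the piece is an interval;
    f is the finite sum of these. *)
Lemma jordan_pieces f : (forall Z, P Z -> jordan Z f) -> jordan I f.
Proof.
move=> fP; apply: (@eq_jordan _ _
  (fun x => \sum_(Z <- fset_set P) (if Z \in P then (f \_ Z) x else 0))).
  move=> x Ix; rewrite -[RHS](piece_sum f Ix) big_seq [RHS]big_seq.
  by apply: eq_bigr => Z; rewrite in_fset_set// => ->.
apply: jordan_sum => Z; have [/set_mem PZ|_] := boolP (Z \in P); last exact: jordan_cst.
apply: (jordanS (@subsetT _ _)); apply: jordan_patch; last exact: fP.
by case: partP => _; apply.
Qed.

Variable T : R -> R.
Hypotheses (TI : forall x, I x -> I (T x))
  (incT : forall Z, P Z -> {in Z &, {homo T : x y / x < y}} \/
    {in Z &, {homo T : x y /~ x < y}})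
  (imT : forall Z, P Z -> is_interval (T @` Z)).

Lemma piece_monotone Z : P Z -> monotone_on Z T.
Proof.
move=> PZ; have [Tinc|Tdec] := incT PZ; [left|right] => x y Zx Zy.
  rewrite le_eqVlt => /predU1P[->//|xy]; apply/ltW/Tinc => //; exact/mem_set.
rewrite le_eqVlt => /predU1P[->//|xy]; apply/ltW/Tdec => //; exact/mem_set.
Qed.

Lemma piece_injective Z x y : P Z -> Z x -> Z y -> T x = T y -> x = y.
Proof.
move=> PZ Zx Zy Txy; apply/eqP; rewrite eq_le !leNgt.
have [Tm|Tm] := incT PZ; apply/andP; split; apply/negP => xy;
  have := Tm _ _ (mem_set _) (mem_set _) xy; rewrite Txy ltxx => h;
  by have := h ltac:(assumption) ltac:(assumption).
Qed.

Lemma jordan_pullback u : jordan I u -> jordan I (u \o T).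
Proof.
move=> uI; apply: jordan_pieces => Z PZ.
by apply: jordan_comp (piece_monotone PZ) _ uI => x /(PI PZ)/TI.
Qed.

Lemma finite_fibre x : finite_set (I `&` T @^-1` [set x]).
Proof.
have -> : I `&` T @^-1` [set x] = \bigcup_(Z in P) (Z `&` T @^-1` [set x]).
  by rewrite -setI_bigcupl; case: partP => -[<-].
apply: bigcup_finite => // Z PZ; apply: (@sub_finite_set _ _
  [set xget 0 (Z `&` T @^-1` [set x])]) => // y Zy.
case: xgetP => [z zE [Zz Tz]|/(_ y)//].
case: Zy => Zy Ty; apply: piece_injective PZ Zy Zz _; by rewrite Ty Tz.
Qed.

Lemma mem_fibre x y : (y \in fset_set (I `&` T @^-1` [set x])) =
  (y \in I `&` T @^-1` [set x]).
Proof. by rewrite in_fset_set//; exact: finite_fibre. Qed.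

(** On T(Z) the contribution of Z to the sum over a fibre is u composed with the
    monotone inverse of T on Z. *)
Lemma jordan_fibre_sum u : jordan I u ->
  jordan I (fun x => \sum_(y \in I `&` T @^-1` [set x]) u y).
Proof.
move=> uI.
pose h Z x := \sum_(y <- fset_set (I `&` T @^-1` [set x])) (u \_ Z) y.
apply: (@eq_jordan _ _ (fun x => \sum_(Z <- fset_set P) (if Z \in P then h Z x else 0))).
  move=> x Ix; rewrite fsbig_finite//=; last exact: finite_fibre.
  rewrite (eq_big_seq (fun Z => h Z x)); last first.
    by move=> Z; rewrite in_fset_set// => ->.
  rewrite /h exchange_big/=; apply: eq_big_seq => y.
  by rewrite mem_fibre => /set_mem[Iy _]; exact: piece_sum.
apply: jordan_sum => Z; have [/set_mem PZ|_] := boolP (Z \in P); last exact: jordan_cst.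
apply: (jordanS (@subsetT _ _)).
pose S x := xget 0 (Z `&` T @^-1` [set x]).
have SK z : Z z -> S (T z) = z.
  move=> Zz; rewrite /S; case: xgetP => [y _ [Zy Ty]|/(_ z)]; last by case.
  exact: piece_injective PZ Zy Zz Ty.
apply: (@eq_jordan _ _ ((u \o S) \_ (T @` Z))).
  move=> x _; rewrite patchE /h; case: ifPn => [/set_mem[z Zz Tz]|nZx].
    rewrite -{x}Tz /= SK//.
    have zin : z \in fset_set (I `&` T @^-1` [set T z]).
      by rewrite mem_fibre; apply/mem_set; split => //; exact: PI Zz.
    rewrite (bigD1_seq z) ?fset_uniq//= patchE mem_set// big_seq_cond big1 ?addr0// => y.
    rewrite mem_fibre => /andP[/set_mem[Iy Ty] yz]; rewrite patchE memNset// => Zy.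
    by case/eqP: yz; exact: piece_injective PZ Zy Zz Ty.
  rewrite big_seq big1// => y; rewrite mem_fibre => /set_mem[Iy Ty].
  rewrite patchE memNset// => Zy; case/negP: nZx.
  by apply/mem_set; exists y.
apply: jordan_patch; first exact: imT.
apply: (@jordan_comp _ _ I) => //; last by move=> _ [z Zz <-]; rewrite SK//; exact: PI Zz.
have [Tm|Tm] := incT PZ; [left|right] => _ _ [x Zx <-] [y Zy <-]; rewrite !SK//.
  move=> Txy; rewrite leNgt; apply/negP => /(Tm _ _ (mem_set Zy) (mem_set Zx)).
  by rewrite ltNge Txy.
move=> Txy; rewrite leNgt; apply/negP => /(Tm _ _ (mem_set Zy) (mem_set Zx)).
by rewrite ltNge Txy.
Qed.

End piecewise_monotone.

(** * Survivors and iterated transfer operators *)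

Section open_system_dynamics.
Context {d : measure_display} {Omega : measurableType d} {R : realType}.
Variables (S : open_system Omega R) (m : probability Omega R).
Hypothesis base : base_system S m.

Local Notation sigma := (shift S).
Local Notation I := (itvI S).

Lemma measurable_itvI : measurable I.
Proof. exact: measurable_itv. Qed.

Lemma itvI_interval : is_interval I.
Proof. exact: interval_is_interval. Qed.

Lemma fmap_itvI w x : I x -> I (fmap S w x).
Proof. by move=> Ix; rewrite -(fmap_image base w); exists x. Qed.

Lemma fmap_iter_itvI n w x : I x -> I (fmap_iter S n w x).
Proof. by move=> Ix; elim: n => [//|n IHn] /=; exact: fmap_itvI. Qed.

Lemma iter_past n w : iter n sigma (past S n w) = w.
Proof.
rewrite /past; elim: n => [//|n IHn].
by rewrite iterSr /= (unshiftK base).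
Qed.

Lemma past_iter n w : past S n (iter n sigma w) = w.
Proof.
rewrite /past; elim: n => [//|n IHn].
by rewrite iterSr /= (shiftK base).
Qed.

Lemma ae_past (P : Omega -> Prop) : {ae m, forall w, P w} ->
  {ae m, forall w, forall n, P (past S n w)}.
Proof.
move=> aeP; apply: (@ae_comp_iter _ _ _ m) => //; first exact: unshift_measurable base.
move=> A mA; rewrite -(shift_preserving base); last first.
  by rewrite -[X in measurable X]setTI; apply: (unshift_measurable base).
congr (m _); apply/seteqP; split=> w /=; by rewrite (shiftK base).
Qed.

(** Unlike the survivor sets this family starts, at n = 0, with the whole interval:
    n is the number of operators applied, as in the integral formulas below. *)
Definition alive (w : Omega) (n : nat) : set R :=
  [set x | I x /\ forall j, (j < n)%N ->
    ~ hole_at S (iter j sigma w) (fmap_iter S j w x)].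

Lemma survivorE w n : survivor S w n = alive w n.+1.
Proof. by apply/seteqP; split=> x [Ix nH]; split => // j jn; exact: nH. Qed.

Lemma alive_sub w n : alive w n `<=` I.
Proof. by move=> x []. Qed.

Lemma alive_anti w n k : (n <= k)%N -> alive w k `<=` alive w n.
Proof. by move=> nk x [Ix H]; split => // j jn; apply: H; exact: leq_trans nk. Qed.

Lemma alive0 w : alive w 0 = I.
Proof. by apply/seteqP; split=> x; [case|split]. Qed.

Lemma alive1 w : alive w 1 = open_itv S w.
Proof.
apply/seteqP; split=> x [Ix nH]; split => //; first exact: (nH 0).
by move=> [|j].
Qed.

Lemma alive_open w n : (0 < n)%N -> alive w n `<=` open_itv S w.
Proof. by move=> n0; rewrite -alive1; exact: alive_anti. Qed.

Lemma indic_aliveS w n x : I x -> \1_(alive w n.+1) x =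
  \1_(alive w n) x * ind_open S (iter n sigma w) (fmap_iter S n w x) :> R.
Proof.
move=> Ix; rewrite /ind_open !indicE -natrM mulnb; congr (_%:R); congr nat_of_bool.
apply/idP/andP => [/set_mem[_ nH]|[/set_mem[_ nH] /set_mem[_ nHn]]].
  split; apply/mem_set; split => //; first by move=> j jn; apply: nH; exact: ltnW.
    exact: fmap_iter_itvI.
  exact: nH.
apply/mem_set; split => // j; rewrite ltnS leq_eqVlt => /predU1P[->//|].
exact: nH.
Qed.

Let skew (p : Omega * R) := (sigma p.1, fmap S p.1 p.2).

Let iter_skew n w x : iter n skew (w, x) = (iter n sigma w, fmap_iter S n w x).
Proof. by elim: n => [//|n /= ->]. Qed.

Let measurable_iter_skew n : measurable_fun (setT `*` I) (iter n skew).
Proof.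
have mTI : measurable ([set: Omega] `*` I).
  by apply: measurableX => //; exact: measurable_itvI.
elim: n => [|n IHn]; first exact: measurable_id.
apply: (measurable_comp mTI _ (skew_measurable base) IHn).
by move=> _ [[w x] [_ /= Ix] <-]; rewrite iter_skew; split => //=; exact: fmap_iter_itvI.
Qed.

Hypothesis hole_meas : measurable (hole S).

Definition alive_graph n : set (Omega * R) := [set p | alive p.1 n p.2].

(** Measurability in the pair of base point and position is what makes the masses
    of the survivors measurable functions of the base point. *)
Lemma measurable_alive_graph n : measurable (alive_graph n).
Proof.
have mTI : measurable ([set: Omega] `*` I).
  by apply: measurableX => //; exact: measurable_itvI.
rewrite (_ : alive_graph n = (setT `*` I) `&`
    \bigcap_(j in [set j | (j < n)%N]) ((setT `*` I) `&` iter j skew @^-1` ~` hole S)).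
  apply: measurableI => //; apply: bigcap_measurableType => j _.
  exact: measurable_iter_skew (measurableC hole_meas).
apply/seteqP; split=> -[w x] /=.
  move=> [Ix nH]; split => // j jn; split => //=; rewrite iter_skew.
  by move=> h; apply: (nH j jn); rewrite /hole_at /xsection /=; apply/mem_set.
move=> [[_ Ix] nH]; split => // j jn h; have [_] := nH j jn.
by rewrite /= iter_skew; apply; move: h; rewrite /hole_at /xsection /= => /set_mem.
Qed.

Lemma alive_xsection n w : xsection (alive_graph n) w = alive w n.
Proof.
apply/seteqP; split=> x; rewrite /xsection /= => h; last exact/mem_set.
exact: set_mem h.
Qed.

Lemma measurable_alive w n : measurable (alive w n).
Proof.
rewrite -alive_xsection; apply: measurable_xsection.
exact: measurable_alive_graph.
Qed.

Lemma measurable_fun_alive (k : R.-pker Omega ~> R) n :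
  measurable_fun setT (fun w => k w (alive w n)).
Proof.
rewrite (_ : (fun w => _) = (fun w => k w (xsection (alive_graph n) w))).
  apply: measurable_fun_xsection_finite_kernel; apply/mem_set.
  exact: measurable_alive_graph.
by apply/funext => w; rewrite alive_xsection.
Qed.

Record regular (w : Omega) : Prop := {
  regular_g0 : jordan I (g0 S w);
  regular_open : jordan I (ind_open S w) }.

Lemma jordan_fmap w u : jordan I u -> jordan I (u \o fmap S w).
Proof.
apply: (@jordan_pullback _ I (branches S w) (branches_finite base w)
  (branches_partition base w)).
- by move=> x; exact: fmap_itvI.
- exact: branches_monotone base w.
Qed.

Lemma jordan_transfer w u : regular w -> jordan I u -> jordan I (transfer S w u).
Proof.
move=> [g0J openJ] uJ; rewrite /transfer /transfer0.
apply: (jordan_fibre_sum (branches_finite base w) (branches_partition base w)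
  (branches_monotone base (w := w)) (branches_image base (w := w))).
by apply: jordanM => //; exact: jordanM.
Qed.

Lemma jordan_transfer_iter w u n : (forall j, regular (iter j sigma w)) ->
  jordan I u -> jordan I (transfer_iter S n w u).
Proof.
move=> wreg uJ; elim: n => [//|n IHn] /=; exact: jordan_transfer.
Qed.

Lemma eq_transfer w u v x : (forall y, I y -> u y = v y) ->
  transfer S w u x = transfer S w v x.
Proof.
by move=> uv; apply: eq_fsbigr => y /set_mem[Iy _]; rewrite uv.
Qed.

Lemma transferZ w (c : R) u x :
  transfer S w (fun y => c * u y) x = c * transfer S w u x.
Proof.
rewrite /transfer /transfer0 mulr_fsumr; apply: eq_fsbigr => y _; ring.
Qed.

Lemma transfer_pullback w u v x :
  u x * transfer S w v x = transfer S w (fun y => u (fmap S w y) * v y) x.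
Proof.
rewrite /transfer /transfer0 mulr_fsumr; apply: eq_fsbigr => y.
by move=> /set_mem[_ /= ->]; ring.
Qed.

Lemma transfer_ge0 w u x : (forall y, I y -> 0 <= u y) -> 0 <= transfer S w u x.
Proof.
move=> u0; apply: fsumr_ge0 => y [Iy _].
by rewrite mulr_ge0 ?expR_ge0// mulr_ge0 ?u0// /ind_open indicE.
Qed.

Lemma transfer_iter_ge0 n w u x : (forall y, I y -> 0 <= u y) -> I x ->
  0 <= transfer_iter S n w u x.
Proof.
by move=> u0; elim: n x => [|n IHn] x Ix /=; [exact: u0|exact: transfer_ge0].
Qed.

(** Moving the test function u through the operators one step at a time leaves at
    each step the indicator of the complement of the hole, and these indicators
    multiply to that of the points still alive. *)
Lemma integral_transfer_iter (mu : Omega -> {measure set R -> \bar R}) lam w :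
  (forall j, regular (iter j sigma w)) ->
  (forall j v, jordan I v ->
    (\int[mu (iter j.+1 sigma w)]_(x in I) (transfer0 S (iter j sigma w) v x)%:E =
     (lam (iter j sigma w))%:E *
       \int[mu (iter j sigma w)]_(x in I) (v x)%:E)%E) ->
  forall n u v, jordan I u -> jordan I v ->
    (\int[mu (iter n sigma w)]_(x in I) (u x * transfer_iter S n w v x)%:E =
     (\prod_(j < n) lam (iter j sigma w))%:E *
       \int[mu w]_(x in I)
         (u (fmap_iter S n w x) * \1_(alive w n) x * v x)%:E)%E.
Proof.
move=> wreg conf; elim=> [|n IHn] u v uJ vJ.
  rewrite big_ord0 mul1e; apply: eq_integral => x /set_mem Ix /=.
  by rewrite alive0 indicE mem_set// mulr1.
set w' := iter n sigma w.
have uTJ : jordan I (fun x => u (fmap S w' x) * ind_open S w' x).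
  by apply: jordanM; [exact: jordan_fmap|exact: (wreg n).(regular_open)].
transitivity (\int[mu (iter n.+1 sigma w)]_(x in I) (transfer0 S w'
    (fun y => u (fmap S w' y) * ind_open S w' y * transfer_iter S n w v y) x)%:E)%E.
  apply: eq_integral => x _; congr EFin; rewrite [LHS]/= transfer_pullback.
  rewrite /transfer /transfer0; apply: eq_fsbigr => y _; rewrite -/w'; ring.
rewrite conf; last by apply: jordanM => //; exact: jordan_transfer_iter.
rewrite IHn// muleA -EFinM big_ord_recr/= mulrC; congr (_ * _)%E.
apply: eq_integral => x /set_mem Ix; congr EFin; rewrite indic_aliveS//=.
by rewrite -/w'; ring.
Qed.

Lemma integral_transfer_iter1 (mu : Omega -> {measure set R -> \bar R}) lam w :
  (forall j, regular (iter j sigma w)) ->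
  (forall j v, jordan I v ->
    (\int[mu (iter j.+1 sigma w)]_(x in I) (transfer S (iter j sigma w) v x)%:E =
     (lam (iter j sigma w))%:E *
       \int[mu (iter j sigma w)]_(x in I) (v x)%:E)%E) ->
  forall n v, jordan I v ->
    (\int[mu (iter n sigma w)]_(x in I) (transfer_iter S n w v x)%:E =
     (\prod_(j < n) lam (iter j sigma w))%:E * \int[mu w]_(x in I) (v x)%:E)%E.
Proof.
move=> wreg conf; elim=> [|n IHn] v vJ; first by rewrite big_ord0 mul1e.
rewrite [LHS]conf; last exact: jordan_transfer_iter.
by rewrite IHn// muleA -EFinM big_ord_recr/= mulrC.
Qed.

Lemma transfer_iter_eigen (lam : Omega -> R) (h : Omega -> R -> R) w :
  (forall j x, I x -> transfer S (iter j sigma w) (h (iter j sigma w)) x =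
     lam (iter j sigma w) * h (iter j.+1 sigma w) x) ->
  forall n x, I x -> transfer_iter S n w (h w) x =
    (\prod_(j < n) lam (iter j sigma w)) * h (iter n sigma w) x.
Proof.
move=> eig; elim=> [|n IHn] x Ix; first by rewrite big_ord0 mul1r.
rewrite [LHS]/= (eq_transfer _ _ (fun y => IHn y)) transferZ eig//.
by rewrite big_ord_recr/= mulrA.
Qed.

End open_system_dynamics.

(** * Integrals and limits *)

Section integrals.
Import HBNNSimple.
Context {d : measure_display} {T : measurableType d} {R : realType}.
Variable mu : {measure set T -> \bar R}.

(** Integrals of nonnegative functions are suprema over simple functions, measurable
    or not. *)
Lemma le_integral_nomeas (f g : T -> \bar R) :
  (forall x, 0 <= f x)%E -> (forall x, f x <= g x)%E ->
  (\int[mu]_x f x <= \int[mu]_x g x)%E.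
Proof.
move=> f0 fg; have g0 x : (0 <= g x)%E := le_trans (f0 x) (fg x).
rewrite !ge0_integralTE//; apply: ereal_sup_le => _ [h hf <-].
by exists h => // x; exact: le_trans (fg x).
Qed.

Lemma ge0_ae_eq_integral_nomeas (f g : T -> \bar R) :
  (forall x, 0 <= f x)%E -> (forall x, 0 <= g x)%E -> measurable_fun setT g ->
  {ae mu, forall x, f x = g x} -> (\int[mu]_x f x = \int[mu]_x g x)%E.
Proof.
move=> f0 g0 mg [N [mN N0 fgN]].
have fg x : ~ N x -> f x = g x.
  by move=> nN; apply: contrapT => h; apply: nN; exact: fgN.
have mNC := measurableC mN.
have offN (h : T -> \bar R) : measurable_fun setT h -> (forall x, 0 <= h x)%E ->
    (\int[mu]_x h x = \int[mu]_x (h \_ (~` N)) x)%E.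
  move=> mh h0; rewrite (ge0_negligible_integral mN)// setTD.
  by rewrite -integral_mkcond.
apply/eqP; rewrite eq_le; apply/andP; split.
  rewrite ge0_integralTE//; apply: ge_ereal_sup => _ [h hf <-].
  rewrite -integralT_nnsfun offN//; last 2 first.
  - by apply/measurable_EFinP; exact: measurable_funPT.
  - by move=> x; rewrite lee_fin.
  apply: le_integral_nomeas => x; rewrite patchE.
    by case: ifPn => // _; rewrite lee_fin.
  by case: ifPn => // /set_mem/fg <-.
rewrite offN//; apply: le_integral_nomeas => x; rewrite patchE.
  by case: ifPn.
by case: ifPn => // /set_mem/fg ->.
Qed.

(** The function f is arbitrary on a null set, hence possibly not measurable. This
    is the situation of log (lam0 / lam): integrability of log lam makes lam
    measurable only where it is positive. *)
Lemma ae_eq_integral_nomeas (f g : T -> \bar R) : measurable_fun setT g ->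
  {ae mu, forall x, f x = g x} -> (\int[mu]_x f x = \int[mu]_x g x)%E.
Proof.
move=> mg fg; rewrite [LHS]integralE [RHS]integralE; congr (_ - _)%E.
  apply: ge0_ae_eq_integral_nomeas => //; first exact: measurable_funepos.
  by apply: filterS fg => x; rewrite !funeposE => ->.
apply: ge0_ae_eq_integral_nomeas => //; first exact: measurable_funeneg.
by apply: filterS fg => x; rewrite !funenegE => ->.
Qed.

Lemma measurable_fine_comp (f : T -> \bar R) : measurable_fun setT f ->
  measurable_fun setT (fine \o f).
Proof. by move=> mf; exact: measurableT_comp. Qed.

Lemma integrable_fine (f : T -> \bar R) : mu.-integrable setT f ->
  mu.-integrable setT (EFin \o (fine \o f)).
Proof.
move=> fi; apply: le_integrable (fi) => //.
  exact/measurable_EFinP/measurable_fine_comp/(measurable_int _ fi).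
by move=> x _ /=; case: (f x) => [r||] //=; rewrite normr0 leey.
Qed.

Lemma integral_fine (f : T -> \bar R) : mu.-integrable setT f ->
  (\int[mu]_x (fine (f x))%:E = \int[mu]_x f x)%E.
Proof.
move=> fi; apply: ae_eq_integral => //.
- exact/measurable_EFinP/measurable_fine_comp/(measurable_int _ fi).
- exact: (measurable_int _ fi).
by apply: filterS (integrable_ae measurableT fi) => x fx _; rewrite fineK// fx.
Qed.
End integrals.

Section uniform_limits.
Context {R : realType}.
Variable mu : {measure set R -> \bar R}.

Lemma jordan_integrable (A : set R) f : measurable A -> is_interval A ->
  (mu A < +oo)%E -> jordan A f -> mu.-integrable A (EFin \o f).
Proof.
move=> mA iA Afin fJ; apply: measurable_bounded_integrable => //.
  exact: jordan_measurable.
have [M M0 fM] := jordan_bounded fJ; exists M; split; first exact: num_real.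
by move=> N MN x Ax; exact: le_trans (fM _ Ax) (ltW MN).
Qed.

Lemma uniform_cvgP (A : set R) (h : nat -> R -> R) (f : R -> R) :
  {uniform A, h @ \oo --> f} -> forall e, 0 < e ->
  \forall n \near \oo, forall x, A x -> `|f x - h n x| <= e.
Proof.
move=> hf e e0.
have : nbhs (f : {uniform` A -> R}) [set g | forall x, A x -> `|f x - g x| <= e].
  apply/uniform_nbhs; exists [set p | ball p.1 e p.2].
  split; first exact: (entourage_ball _ (PosNum e0)).
  by move=> g fg x /fg; rewrite -ball_normE/= => /ltW.
by move/hf.
Qed.

Lemma uniform_cvg_Rintegral (A : set R) (h : nat -> R -> R) (f : R -> R) :
  measurable A -> is_interval A -> (mu A < +oo)%E -> jordan A f ->
  (forall n, jordan A (h n)) -> {uniform A, h @ \oo --> f} ->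
  \int[mu]_(x in A) h n x @[n --> \oo] --> \int[mu]_(x in A) f x.
Proof.
move=> mA iA Afin fJ hJ /uniform_cvgP hf; apply/cvgrPdist_le => e e0.
have fi := jordan_integrable mA iA Afin fJ.
have hi n := jordan_integrable mA iA Afin (hJ n).
have K0 : 0 < fine (mu A) + 1 by rewrite ltr_wpDl// fine_ge0.
have := hf _ (divr_gt0 e0 K0); apply: filterS => n hn.
rewrite -RintegralB//; apply: le_trans (le_normr_Rintegral mA _) _.
  exact: (integrableB mA fi (hi n)).
have ce : mu.-integrable A (EFin \o (cst (e / (fine (mu A) + 1)) : R -> R)).
  by apply: jordan_integrable => //; exact: jordan_cst.
apply: (@le_trans _ _ (\int[mu]_(x in A) (e / (fine (mu A) + 1)))).
  apply: le_Rintegral => //.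
  exact: (integrable_norm (integrableB mA fi (hi n))).
rewrite Rintegral_cst// mulrAC ler_pdivrMr// ler_wpM2l ?(ltW e0)//.
by rewrite lerDl.
Qed.

End uniform_limits.

Lemma log_integrable_gt0 d (Omega : measurableType d) (R : realType)
    (m : probability Omega R) (u : Omega -> R) :
  log_integrable m (fun w => (u w)%:E) -> {ae m, forall w, 0 < u w}.
Proof.
move=> /(integrable_ae measurableT); apply: filterS => w /(_ I) /=.
by case: ltP.
Qed.

Section escape.
Context {d : measure_display} {Omega : measurableType d} {R : realType}.
Variable S : open_system Omega R.

Lemma escape_rate_cvg (zeta : set R -> \bar R) w (z : nat -> R) (a : R) :
  (forall n, zeta (survivor S w n) = (z n)%:E) -> (forall n, 0 < z n) ->
  n%:R^-1 * ln (z n) @[n --> \oo] --> - a ->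
  escape_rate_exists S zeta w /\ escape_rate S zeta w = a%:E.
Proof.
move=> zE z0 za; have lE : log_survival S zeta w = EFin \o (fun n => n%:R^-1 * ln (z n)).
  by apply/funext => n; rewrite /log_survival zE lne_EFin.
have /cvg_limn_einf_sup[einfE esupE] : log_survival S zeta w @ \oo --> (- a)%:E.
  by rewrite lE; apply: cvg_EFin za; exact: nearW.
split.
  by rewrite /escape_rate_exists /lower_escape_rate /upper_escape_rate einfE esupE.
by rewrite /escape_rate /lower_escape_rate esupE -EFinN opprK.
Qed.

End escape.

(** * The rescaled mass of the survivors *)

Lemma fine_of_mule (R : realType) (a b : R) (x : \bar R) : 0 < b ->
  (a%:E = b%:E * x)%E -> fine x = a / b.
Proof.
move=> b0; case: x => [r| |].
- by move=> [->]; rewrite mulrAC divff ?mul1r ?gt_eqF.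
- by rewrite gt0_muley.
- by rewrite gt0_muleNy.
Qed.

Section escape_rates.
Context {d : measure_display} {Omega : measurableType d} {R : realType}.
Variables (m : probability Omega R) (S : open_system Omega R).
Variables (nu0 : R.-pker Omega ~> R) (lam0 : Omega -> R) (phi0 : Omega -> R -> R).
Variables (calA Zhat : Omega -> nat -> set (set R)).
Variables (nu : Omega -> probability R R) (lam : Omega -> R).
Variables (phi : Omega -> R -> R) (eta : Omega -> probability R R).
Hypothesis base : base_system S m.
Hypothesis closed : closed_system S m nu0 lam0 phi0.
Hypothesis holed : holes S m nu0.
Hypothesis Qs : Q_assumptions S m calA Zhat.
Hypothesis assoc : associated S m nu0 nu lam phi eta.

Local Notation sigma := (shift S).
Local Notation I := (itvI S).
Local Notation alive := (alive S).

Let mI : measurable I := measurable_itvI S.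
Let iI : is_interval I := @itvI_interval _ _ _ S.
Let mAlive w n : measurable (alive w n) := measurable_alive base (hole_measurable holed) w n.

Let nu0_lty w : (nu0 w I < +oo)%E.
Proof. by rewrite (nu0_itvI closed w) ltry. Qed.

(** The cutting partition of order 1 makes g0 times the indicator of the open part
    of bounded variation on each of finitely many intervals. Dividing by g0, which
    is bounded below since the potential has an integrable infimum, isolates the
    indicator. *)
Lemma ae_regular : {ae m, forall w, regular S w}.
Proof.
have infA := integrable_ae measurableT (potential_inf_integrable closed).
apply: filterS3 infA (g0_BV closed) (calA_admissible Qs) => w /(_ Logic.I).
move=> infw /BVP g0J /(_ 1%N isT)[cutfin cutI cutv].
split => //.
have [M M0 gM] := jordan_bounded g0J.
have g1E x : I x -> g_iter S 1 w x = g0 S w x * ind_open S w x.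
  move=> Ix; rewrite /g_iter /g0_iter big_ord_recl big_ord0 mulr1/=.
  by rewrite survivorE alive1 /ind_open.
have g1M x : I x -> `|g_iter S 1 w x| <= M.
  move=> Ix; rewrite g1E// normrM -[M]mulr1 ler_pM ?gM//.
  by rewrite /ind_open indicE; case: (_ \in _); rewrite ?normr1 ?normr0.
have g1J : jordan I (g_iter S 1 w).
  apply: (jordan_pieces cutfin cutI) => A cutA; apply/BVP.
  have AI : A `<=` I by case: cutI => -[<- _ _] _; exact: bigcup_sup.
  have supM (B : set R) : B `<=` I -> (sup_norm B (g_iter S 1 w) <= M%:E)%E.
    by move=> BI; apply: ge_ereal_sup => _ [x /BI Ix <-]; rewrite lee_fin g1M.
  split; first exact: le_lt_trans (supM _ AI) (ltry _).
  apply: le_lt_trans (cutv _ cutA) _.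
  apply: (@le_lt_trans _ _ (2 * M)%:E); last exact: ltry.
  by rewrite EFinM lee_pmul2l ?supM//.
pose b := fine (ereal_inf [set (potential S w x)%:E | x in I]).
have bg x : I x -> expR b <= g0 S w x.
  move=> Ix; rewrite ler_expR -lee_fin fineK//.
  by apply: ereal_inf_lbound; exists x.
apply: (@eq_jordan _ _ (fun x => g_iter S 1 w x * (g0 S w x)^-1)).
  by move=> x Ix; rewrite g1E// mulrAC divff ?mul1r// gt_eqF ?expR_gt0.
apply: jordanM => //; exact: jordanV (expR_gt0 b) bg g0J.
Qed.

Lemma ae_lam0_gt0 : {ae m, forall w, 0 < lam0 w}.
Proof. exact: log_integrable_gt0 (lam0_log_integrable closed). Qed.

Lemma ae_lam_gt0 : {ae m, forall w, 0 < lam w}.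
Proof. exact: log_integrable_gt0 (lam_log_integrable assoc). Qed.

Definition log_ratio (w : Omega) : R :=
  fine (lne (lam0 w)%:E) - fine (lne (lam w)%:E).

Let ilam0 : m.-integrable setT (fun w => lne (lam0 w)%:E) := lam0_log_integrable closed.
Let ilam : m.-integrable setT (fun w => lne (lam w)%:E) := lam_log_integrable assoc.

Lemma measurable_log_ratio : measurable_fun setT log_ratio.
Proof.
apply: measurable_funB; first exact: measurable_fine_comp (measurable_int _ ilam0).
exact: measurable_fine_comp (measurable_int _ ilam).
Qed.

Lemma integrable_log_ratio : m.-integrable setT (EFin \o log_ratio).
Proof. exact: (integrableB measurableT (integrable_fine ilam0) (integrable_fine ilam)). Qed.

Lemma integral_log_ratio : (\int[m]_w (log_ratio w)%:E =
  expected_pressure m lam0 - expected_pressure m lam)%E.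
Proof.
rewrite /log_ratio; under eq_integral do rewrite EFinB.
rewrite integralB//=; last 2 first.
- exact: integrable_fine ilam0.
- exact: integrable_fine ilam.
by rewrite (integral_fine ilam0) (integral_fine ilam).
Qed.

Lemma log_ratioE w : 0 < lam0 w -> 0 < lam w -> expR (log_ratio w) = lam0 w / lam w.
Proof. by move=> l0 l; rewrite /log_ratio !lne_EFin//= expRD expRN !lnK. Qed.

Lemma integral_lne_ratio :
  (\int[m]_w lne (lam0 w / lam w)%:E = \int[m]_w (log_ratio w)%:E)%E.
Proof.
apply: ae_eq_integral_nomeas; first exact/measurable_EFinP/measurable_log_ratio.
apply: filterS2 ae_lam0_gt0 ae_lam_gt0 => w l0 l.
by rewrite -log_ratioE// lne_EFin ?expR_gt0// expRK.
Qed.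

Lemma expR_birkhoff_sum n w :
  (forall j, 0 < lam0 (iter j sigma w) /\ 0 < lam (iter j sigma w)) ->
  expR (birkhoff_sum sigma log_ratio n w) =
  (\prod_(j < n) lam0 (iter j sigma w)) / \prod_(j < n) lam (iter j sigma w).
Proof.
move=> l; rewrite /birkhoff_sum expR_sum -prodf_div.
by apply: eq_bigr => j _; have [? ?] := l j; rewrite log_ratioE.
Qed.

(** The almost sure hypotheses at a single fibre, with bounded variation in the form
    [jordan]. *)
Record generic (w : Omega) : Prop := {
  gen_regular : regular S w;
  gen_lam0 : 0 < lam0 w;
  gen_lam : 0 < lam w;
  gen_nu0 : forall f, jordan I f ->
    (\int[nu0 (sigma w)]_(x in I) (transfer0 S w f x)%:E =
     (lam0 w)%:E * \int[nu0 w]_(x in I) (f x)%:E)%E;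
  gen_nu : forall f, jordan I f ->
    (\int[nu (sigma w)]_(x in I) (transfer S w f x)%:E =
     (lam w)%:E * \int[nu w]_(x in I) (f x)%:E)%E;
  gen_Lambda : forall f, jordan I f ->
    (Lambda S w f)%:E = (\int[nu w]_(x in I) (f x)%:E)%E;
  gen_survivor : nu w (survivor_oo S w) = 1%E;
  gen_limit : {uniform I, (fun (n : nat) (x : R) =>
        transfer_iter S n (past S n w) (ind_open S (past S n w)) x /
        Lambda S w (transfer_iter S n (past S n w) (ind_open S (past S n w))))
      @ \oo --> phi w};
  gen_eigen : forall x, I x -> transfer S w (phi w) x = lam w * phi (sigma w) x;
  gen_eta : forall A, measurable A -> eta w A =
    ((\int[nu0 w]_(x in A `&` I) (ind_open S w x * phi w x)) /
     (\int[nu0 w]_(x in I) (ind_open S w x * phi w x)))%:E }.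

Let ae_and (P Q : Omega -> Prop) : {ae m, forall w, P w} ->
  {ae m, forall w, Q w} -> {ae m, forall w, P w /\ Q w}.
Proof. by apply: filterS2 => w; split. Qed.

Lemma ae_generic : {ae m, forall w, generic w}.
Proof.
have h1 := ae_and ae_regular (ae_and ae_lam0_gt0 ae_lam_gt0).
have h2 := ae_and (nu0_conformal closed) (ae_and (nu_conformal assoc) (nu_Lambda assoc)).
have h3 := ae_and (nu_survivor_oo assoc) (ae_and (phi_limit assoc) (phi_eigen assoc)).
have h4 := ae_and h1 (eta_density assoc).
apply: filterS3 h4 h2 h3.
move=> w [[? [? ?]] ?] [conf0 [conf Lam]] [? [? ?]]; split => //.
- by move=> f /BVP; exact: conf0.
- by move=> f /BVP; exact: conf.
- by move=> f /BVP; exact: Lam.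
Qed.

Definition generic_orbit (w : Omega) : Prop :=
  forall n j, generic (iter j sigma (past S n w)).

Lemma ae_generic_orbit : {ae m, forall w, generic_orbit w}.
Proof.
have := ae_comp_iter (shift_measurable base) (shift_preserving base) ae_generic.
by move=> /(ae_past base).
Qed.

Lemma generic_forward w : generic_orbit w -> forall j, generic (iter j sigma w).
Proof. by move=> h j; exact: (h 0%N j). Qed.

Section generic_fibre.
Variable w : Omega.
Hypothesis gw : forall j, generic (iter j sigma w).

Let reg j : regular S (iter j sigma w) := gen_regular (gw j).

Lemma prod_lam0_gt0 n : 0 < \prod_(j < n) lam0 (iter j sigma w).
Proof. by apply: prodr_gt0 => j _; exact: gen_lam0 (gw j). Qed.

Lemma prod_lam_gt0 n : 0 < \prod_(j < n) lam (iter j sigma w).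
Proof. by apply: prodr_gt0 => j _; exact: gen_lam (gw j). Qed.

Lemma transfer_iter_open_jordan n :
  jordan I (transfer_iter S n w (ind_open S w)).
Proof. by apply: (jordan_transfer_iter base) => //; exact: (reg 0).(regular_open). Qed.

Lemma integral_transfer_open n : (0 < n)%N ->
  (\int[nu0 (iter n sigma w)]_(x in I) (transfer_iter S n w (ind_open S w) x)%:E =
   (\prod_(j < n) lam0 (iter j sigma w))%:E * nu0 w (alive w n))%E.
Proof.
move=> n0; have openJ := (reg 0).(regular_open).
have E := @integral_transfer_iter _ _ _ _ _ base (fun w => nu0 w) lam0 w reg
  (fun j => gen_nu0 (gw j)) n (fun=> 1) _ (jordan_cst _ _) openJ.
apply: etrans (etrans E _); first by apply: eq_integral => x _; rewrite mul1r.
congr (_ * _)%E.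
transitivity (\int[nu0 w]_(x in I) (\1_(alive w n) x)%:E)%E.
  apply: eq_integral => x _; congr EFin; rewrite mul1r /ind_open !indicE -natrM mulnb.
  congr (_%:R); congr nat_of_bool; apply/andP/idP => [[]//|xA]; split => //.
  by apply/mem_set; apply: alive_open n0 _ (set_mem xA).
rewrite integral_indic//; congr (nu0 w _).
by apply: setIidl; exact: alive_sub.
Qed.

Lemma Lambda_transfer_open n :
  Lambda S (iter n sigma w) (transfer_iter S n w (ind_open S w)) =
  \prod_(j < n) lam (iter j sigma w).
Proof.
have openJ := (reg 0).(regular_open).
apply: EFin_inj; rewrite (gen_Lambda (gw n)); last exact: transfer_iter_open_jordan.
rewrite (@integral_transfer_iter1 _ _ _ _ _ base (fun w => nu w) lam w reg
  (fun j => gen_nu (gw j)))// -[RHS]mule1; congr (_ * _)%E.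
rewrite integral_indic//; last by rewrite -(alive1 S w); exact: mAlive.
rewrite setIidl; last by move=> x [].
have mo : measurable (open_itv S w) by rewrite -(alive1 S w); exact: mAlive.
apply/eqP; rewrite eq_le probability_le1//= -(gen_survivor (gw 0)).
apply: le_measure; [apply/mem_set|exact/mem_set|].
  by apply: bigcapT_measurable => k; rewrite survivorE; exact: mAlive.
by move=> x /(_ 0%N Logic.I); rewrite survivorE; exact: alive_open.
Qed.

Lemma transfer_iter_phi n x : I x -> transfer_iter S n w (phi w) x =
  (\prod_(j < n) lam (iter j sigma w)) * phi (iter n sigma w) x.
Proof. by apply: transfer_iter_eigen => j y; exact: gen_eigen (gw j) y. Qed.

End generic_fibre.

Definition phi_mass0 (w : Omega) : R := \int[nu0 w]_(x in I) phi w x.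

Definition open_phi_mass0 (w : Omega) : R :=
  \int[nu0 w]_(x in I) (ind_open S w x * phi w x).

Let phiJ w : jordan I (phi w).
Proof. by apply/BVP; case: (phi_BV assoc) => + _ _ _; exact. Qed.

Let integrable_jordan w f : jordan I f -> (nu0 w).-integrable I (EFin \o f).
Proof. exact: jordan_integrable. Qed.

(** The rescaled mass of the survivors that start n steps in the past and arrive in
    the fibre w. *)
Definition pulled_mass (n : nat) (w : Omega) : R :=
  fine (nu0 (past S n w) (alive (past S n w) n)) *
    expR (birkhoff_sum sigma log_ratio n (past S n w)).

Lemma measurable_pulled_mass n : measurable_fun setT (pulled_mass n).
Proof.
have mp : measurable_fun setT (past S n).
  rewrite /past; elim: n => [|n IHn]; first exact: measurable_id.
  exact: (measurableT_comp (unshift_measurable base) IHn).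
apply: measurable_funM.
  have ma := measurable_fun_alive base (hole_measurable holed) nu0 n.
  exact: (measurable_fine_comp (measurableT_comp ma mp)).
apply: measurableT_comp => //.
have mS := measurable_birkhoff_sum (shift_measurable base) n measurable_log_ratio.
exact: (measurableT_comp mS mp).
Qed.

Section generic_two_sided.
Variable w : Omega.
Hypothesis gw : generic_orbit w.

Let gwf := generic_forward gw.

Let hseq (n : nat) (x : R) : R :=
  transfer_iter S n (past S n w) (ind_open S (past S n w)) x /
  Lambda S w (transfer_iter S n (past S n w) (ind_open S (past S n w))).

Let hseqE n x : hseq n x =
  (\prod_(j < n) lam (iter j sigma (past S n w)))^-1 *
  transfer_iter S n (past S n w) (ind_open S (past S n w)) x.
Proof.
rewrite /hseq; have := Lambda_transfer_open (gw n) n.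
by rewrite (iter_past base) => ->; rewrite mulrC.
Qed.

Let hseq_cvg : {uniform I, hseq @ \oo --> phi w} := gen_limit (gwf 0).

Lemma phi_ge0 x : I x -> 0 <= phi w x.
Proof.
move=> Ix; apply/ler_addgt0Pr => e e0.
have [N _ hN] := uniform_cvgP hseq_cvg e0.
have := hN N (leqnn N) x Ix; rewrite ler_norml => /andP[+ _].
have : 0 <= hseq N x.
  rewrite hseqE; apply: mulr_ge0.
    by rewrite invr_ge0 ltW// (prod_lam_gt0 (gw N)).
  by apply: transfer_iter_ge0 => // y Iy; rewrite /ind_open indicE.
lra.
Qed.

(** A vanishing denominator would give eta w total mass 0. *)
Lemma open_phi_mass0_gt0 : 0 < open_phi_mass0 w.
Proof.
rewrite lt_neqAle Rintegral_ge0 ?andbT => [|x Ix]; last first.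
  by rewrite mulr_ge0 ?phi_ge0// /ind_open indicE.
apply/eqP => D0; have := gen_eta (gwf 0) measurableT; rewrite setTI /=.
rewrite -/(open_phi_mass0 w) -D0 mul0r => eT.
have := probability_setT (eta w); rewrite eT => /eqP.
by rewrite eqe eq_sym oner_eq0.
Qed.

Lemma phi_mass0_gt0 : 0 < phi_mass0 w.
Proof.
apply: lt_le_trans open_phi_mass0_gt0 _; apply: le_Rintegral => //.
- apply: integrable_jordan; apply: jordanM => //.
  exact: (gen_regular (gwf 0)).(regular_open).
- exact: integrable_jordan.
move=> x Ix; rewrite -[leRHS]mul1r ler_wpM2r ?phi_ge0//.
by rewrite /ind_open indicE lern1 leq_b1.
Qed.

(** This mass is the integral over the fibre w of the normalised iterate whose
    uniform limit is phi w. *)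
Lemma pulled_mass_cvg : pulled_mass n.+1 w @[n --> \oo] --> phi_mass0 w.
Proof.
have hJ n : jordan I (hseq n).
  apply: (@eq_jordan _ _ (fun x => (\prod_(j < n) lam (iter j sigma (past S n w)))^-1 *
    transfer_iter S n (past S n w) (ind_open S (past S n w)) x)).
    by move=> x _; rewrite hseqE.
  apply: jordanM; first exact: jordan_cst.
  exact: transfer_iter_open_jordan (gw n) n.
have := uniform_cvg_Rintegral mI iI (nu0_lty w) (phiJ w) hJ hseq_cvg.
rewrite -(cvg_shiftS (fun n => \int[nu0 w]_(x in I) hseq n x)).
apply: cvg_trans; apply: near_eq_cvg; apply: nearW => n.
transitivity (\int[nu0 w]_(x in I)
    ((\prod_(j < n.+1) lam (iter j sigma (past S n.+1 w)))^-1 *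
     transfer_iter S n.+1 (past S n.+1 w) (ind_open S (past S n.+1 w)) x)).
  by apply: eq_Rintegral => x _; rewrite hseqE.
rewrite RintegralZl//; last first.
  by apply: integrable_jordan; exact: transfer_iter_open_jordan (gw n.+1) n.+1.
have := integral_transfer_open (gw n.+1) (ltn0Sn n).
rewrite (iter_past base) /Rintegral => ->.
rewrite /pulled_mass expR_birkhoff_sum; last first.
  by move=> j; split; [exact: gen_lam0 (gw n.+1 j)|exact: gen_lam (gw n.+1 j)].
rewrite fineM//; last first.
  rewrite ge0_fin_numE//; apply: le_lt_trans (nu0_lty (past S n.+1 w)).
  by apply: le_measure; [exact/mem_set|exact/mem_set|exact: alive_sub].
by rewrite [fine (EFin _)]/= mulrC [_ * fine (nu0 _ _)]mulrC -mulrA.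
Qed.

(** By the eigenvalue equation the n-th iterate of phi w is a multiple of phi at
    iter n sigma w, so that conformality computes the integral exactly. *)
Lemma integral_phi_alive n : (0 < n)%N ->
  \int[nu0 w]_(x in alive w n `&` I) (ind_open S w x * phi w x) =
  expR (- birkhoff_sum sigma log_ratio n w) * phi_mass0 (iter n sigma w).
Proof.
move=> n0; have lam00 := prod_lam0_gt0 gwf n; have lamn0 := prod_lam_gt0 gwf n.
have lam_gt0 j : 0 < lam0 (iter j sigma w) /\ 0 < lam (iter j sigma w).
  by split; [exact: gen_lam0 (gwf j)|exact: gen_lam (gwf j)].
rewrite expRN expR_birkhoff_sum// invf_div Rintegral_mkcondl.
transitivity (\int[nu0 w]_(x in I) (1 * \1_(alive w n) x * phi w x)).
  apply: eq_Rintegral => x _; rewrite patchE indicE; case: ifPn => xA; last first.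
    by rewrite mulr0 mul0r.
  by rewrite /ind_open indicE mem_set ?mulr1//; exact: alive_open n0 _ (set_mem xA).
have := @integral_transfer_iter _ _ _ _ _ base (fun w => nu0 w) lam0 w
  (fun j => gen_regular (gwf j)) (fun j => gen_nu0 (gwf j)) n (fun=> 1) _
  (jordan_cst _ _) (phiJ w).
rewrite [X in X = _](_ : _ = ((\prod_(j < n) lam (iter j sigma w)) *
    phi_mass0 (iter n sigma w))%:E); last first.
  rewrite EFinM fineK; last exact: integrable_fin_num (integrable_jordan _ (phiJ _)).
  rewrite -integralZl//; last exact: integrable_jordan.
  by apply: eq_integral => x /set_mem Ix; rewrite mul1r transfer_iter_phi.
move=> /(fine_of_mule lam00) E; rewrite /Rintegral.
by rewrite [LHS]E mulrAC.
Qed.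

End generic_two_sided.

(** * The escape rates *)

(** A single parameter C serves as bound above, as bound below and as the time after
    which the bound below is demanded, so that countably many of these sets cover
    almost every fibre. *)
Definition moderate (C : nat) : set Omega :=
  [set w | forall n, pulled_mass n.+1 w <= C.+1%:R /\
    ((C <= n)%N -> C.+1%:R^-1 <= pulled_mass n.+1 w)].

Lemma measurable_moderate C : measurable (moderate C).
Proof.
have mF n (A : set R) : measurable A -> measurable (pulled_mass n.+1 @^-1` A).
  by move=> mA; rewrite -[X in measurable X]setTI; exact: measurable_pulled_mass.
rewrite (_ : moderate C = \bigcap_n (pulled_mass n.+1 @^-1` `]-oo, C.+1%:R]) `&`
    \bigcap_(n in [set n | (C <= n)%N]) (pulled_mass n.+1 @^-1` `[C.+1%:R^-1, +oo[)).
  apply: measurableI; first by apply: bigcapT_measurable => n; exact: mF.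
  by apply: bigcap_measurableType => n _; exact: mF.
apply/seteqP; split=> w /=.
  move=> h; split=> n; first by move=> _ /=; rewrite in_itv/=; case: (h n).
  by move=> Cn /=; rewrite in_itv/= andbT; case: (h n) => _; exact.
move=> [h1 h2] n; split; first by have := h1 n Logic.I; rewrite /= in_itv.
by move=> Cn; have := h2 n Cn; rewrite /= in_itv/= andbT.
Qed.

Lemma generic_moderate w : generic_orbit w -> exists C, moderate C w.
Proof.
move=> gw; have Fc := pulled_mass_cvg gw; have c0 := phi_mass0_gt0 gw.
have [M [_ FM]] := cvg_seq_bounded (cvgP _ Fc).
have c20 : 0 < phi_mass0 w / 2 by rewrite divr_gt0.
have /cvgrPdist_le/(_ _ c20)[N _ hN] := Fc.
pose C := maxn (Num.bound (`|M| + 1)) (maxn N (Num.bound (phi_mass0 w / 2)^-1)).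
have leC (x : R) : 0 <= x -> (Num.bound x <= C)%N -> x <= C.+1%:R.
  move=> x0 xC; apply: le_trans (ltW (archi_boundP x0)) _; rewrite ler_nat.
  exact: leq_trans xC (leqnSn _).
exists C => n; split.
  apply: (le_trans (ler_norm _)); apply: le_trans (FM (`|M| + 1) _ n Logic.I) _.
    by rewrite ltr_pwDr// ler_norm.
  by apply: leC; rewrite ?addr_ge0 ?leq_maxl.
have NC : (N <= C)%N by rewrite !leq_max leqnn orbT.
move=> Cn; have := hN n (leq_trans NC Cn).
rewrite ler_norml => /andP[_ Fn].
apply: (@le_trans _ _ (phi_mass0 w / 2)); last by lra.
rewrite -[leRHS]invrK lef_pV2 ?posrE ?invr_gt0//.
by apply: leC; rewrite ?invr_ge0 ?(ltW c20) ?leq_max ?leqnn ?orbT.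
Qed.

Lemma moderate_positive : exists C, (0 < m (moderate C))%E.
Proof.
apply: contrapT => noC.
have : {ae m, forall w, forall C, ~ moderate C w}.
  apply: ae_foralln => C; exists (moderate C); split.
  - exact: measurable_moderate.
  - apply/eqP; rewrite eq_le measure_ge0 andbT leNgt; apply/negP => C0.
    by apply: noC; exists C.
  - by move=> w /= /contrapT.
move=> /(ae_and ae_generic_orbit) [N [mN N0 subN]].
suff NT : N = setT.
  by move: (probability_setT m); rewrite -NT N0 => /esym/eqP; rewrite onee_eq0.
apply/seteqP; split=> // w _; apply: subN => -[gw nm].
by have [C wC] := generic_moderate gw; exact: nm wC.
Qed.

(** At the visits of the orbit to moderate C, the upper bound concerns nu0 and the
    lower one, which passes to the limit phi_mass0 of the masses, concerns eta. The
    visits are counted from sigma w since survivor w n has survived n.+1 steps. *)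
Lemma escape_rates_generic C w : (forall j, generic_orbit (iter j sigma w)) ->
  @frequent R [set n | moderate C (iter n sigma (sigma w))] ->
  n%:R^-1 * birkhoff_sum sigma log_ratio n (sigma w) @[n --> \oo] -->
    fine (\int[m]_w (log_ratio w)%:E)%E ->
  [/\ escape_rate_exists S (nu0 w) w, escape_rate_exists S (eta w) w,
      escape_rate S (nu0 w) w = \int[m]_w (log_ratio w)%:E &
      escape_rate S (eta w) w = \int[m]_w (log_ratio w)%:E]%E.
Proof.
move=> gw freq birk; have gw0 := gw 0%N; have D0 := open_phi_mass0_gt0 gw0.
set a := fine _ in birk.
rewrite -(fineK (integrable_fin_num measurableT integrable_log_ratio)) -/a.
pose Sn n := birkhoff_sum sigma log_ratio n.+1 w.
pose Y n := alive w n.+1; have mY n : measurable (Y n) := mAlive w n.+1.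
pose pm n := phi_mass0 (iter n.+1 sigma w).
have pm0 n : 0 < pm n := phi_mass0_gt0 (gw n.+1).
pose en n := expR (- Sn n) * pm n / open_phi_mass0 w.
have en0 n : 0 < en n by rewrite divr_gt0// mulr_gt0// expR_gt0.
have etaE n : eta w (survivor S w n) = (en n)%:E.
  rewrite survivorE (gen_eta (generic_forward gw0 0))//=.
  by rewrite integral_phi_alive.
pose an n := fine (nu0 w (Y n)).
have nuE n : nu0 w (survivor S w n) = (an n)%:E.
  rewrite survivorE fineK// ge0_fin_numE//; apply: le_lt_trans (nu0_lty w).
  by apply: le_measure; [exact/mem_set|exact/mem_set|exact: alive_sub].
(* M may be 0, whereas the logarithm of M + 1 enters the constant K below. *)
have [M M0 phiM] := jordan_bounded (phiJ w).
have M10 : 0 < M + 1 by rewrite ltr_wpDl.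
have en_an n : en n <= (M + 1) / open_phi_mass0 w * an n.
  rewrite mulrAC ler_pM2r ?invr_gt0// /en /pm -integral_phi_alive//.
  have AI : Y n `&` I = Y n by apply: setIidl; exact: alive_sub.
  have mA : measurable (Y n `&` I) by rewrite AI; exact: mAlive.
  have AsI : Y n `&` I `<=` I by [].
  have -> : (M + 1) * an n = \int[nu0 w]_(x in Y n `&` I) (M + 1).
    by rewrite Rintegral_cst// /an AI.
  apply: le_Rintegral => //.
  - apply: (integrableS mI mA AsI); apply: integrable_jordan; apply: jordanM => //.
    exact: (gen_regular (generic_forward gw0 0)).(regular_open).
  - apply: (integrableS mI mA AsI); apply: integrable_jordan; exact: jordan_cst.
  move=> x [_ Ix]; apply: le_trans (ler_norm _) _; rewrite normrM.
  rewrite -[leRHS]mul1r ler_pM// ?normr_ge0//.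
    by rewrite /ind_open indicE; case: (_ \in _); rewrite ?normr1 ?normr0.
  by apply: le_trans (phiM _ Ix) _; rewrite lerDl.
have an0 n : 0 < an n.
  have := lt_le_trans (en0 n) (en_an n); rewrite pmulr_rgt0// divr_gt0//.
have Y_anti n k : (n <= k)%N -> Y k `<=` Y n by move=> nk; apply: alive_anti.
have freq_hit n : moderate C (iter n sigma (sigma w)) ->
    an n * expR (Sn n) <= C.+1%:R /\ C.+1%:R^-1 <= pm n.
  rewrite -iterSr => mod; split.
    by have [+ _] := mod n; rewrite /pulled_mass (past_iter base).
  have := pulled_mass_cvg (gw n.+1) => Fc.
  rewrite /pm -(cvg_lim _ Fc)//; apply: limr_ge; first exact: cvgP Fc.
  by exists C => // k /= Ck; have [_] := mod k; apply.
have ln_mono (x y : R) : 0 < x -> x <= y -> ln x <= ln y.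
  by move=> x0 xy; rewrite ler_ln ?posrE// (lt_le_trans x0).
have C0 : 0 < C.+1%:R^-1 :> R by rewrite invr_gt0.
have lnC : 0 <= ln C.+1%:R :> R by rewrite ln_ge0// ler1n.
pose K : R := ln C.+1%:R + `|ln (open_phi_mass0 w)| + `|ln (M + 1)|.
have K0 : 0 <= K by rewrite !addr_ge0.
have [] := @rate_along_frequent R (fun n => ln (an n)) (fun n => ln (en n))
  (fun n => - Sn n) (- a) K _ freq K0.
- move=> n k nk /=; rewrite ler_ln ?posrE// /an -lee_fin -!nuE !survivorE.
  by apply: le_measure; [exact/mem_set|exact/mem_set|exact: Y_anti].
- move=> n k nk /=; rewrite ler_ln ?posrE// -lee_fin -!etaE !survivorE.
  by apply: le_measure; [exact/mem_set|exact/mem_set|exact: Y_anti].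
- move=> n /=; have := ln_mono _ _ (en0 n) (en_an n).
  rewrite lnM ?posrE// ?divr_gt0// lnM ?posrE// ?invr_gt0// lnV ?posrE//.
  have := ler_norm (ln (M + 1)); have := ler_norm (- ln (open_phi_mass0 w)).
  by rewrite normrN /K; lra.
- move=> n /freq_hit[/(ln_mono _ _ (mulr_gt0 (an0 n) (expR_gt0 _))) + _] /=.
  rewrite lnM ?posrE// ?expR_gt0// expRK.
  have := normr_ge0 (ln (open_phi_mass0 w)); have := normr_ge0 (ln (M + 1)).
  by rewrite /K; lra.
- move=> n /freq_hit[_ /(ln_mono _ _ C0)] /=; rewrite lnV ?posrE//.
  rewrite /en lnM ?posrE ?mulr_gt0 ?expR_gt0 ?invr_gt0//.
  rewrite lnM ?posrE ?expR_gt0// expRK lnV ?posrE//.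
  have := ler_norm (ln (open_phi_mass0 w)); have := normr_ge0 (ln (M + 1)).
  by rewrite /K; lra.
- rewrite (_ : (fun n => _) = (fun n => - (n%:R^-1 * log_ratio w +
      n%:R^-1 * birkhoff_sum sigma log_ratio n (sigma w)))); last first.
    by apply/funext => n; rewrite /Sn birkhoff_sumS mulrN mulrDr.
  apply: cvgN; rewrite -[a]add0r; apply: cvgD => //.
  rewrite -[X in _ --> X](mul0r (log_ratio w)); apply: cvgMl.
  by rewrite -(cvg_shiftS (fun n : nat => n%:R^-1 : R)); exact: cvg_harmonic.
move=> /(escape_rate_cvg nuE an0)[? ?] /(escape_rate_cvg etaE en0)[? ?].
by split.
Qed.

Lemma ae_escape_rates : {ae m, forall w,
  [/\ escape_rate_exists S (nu0 w) w, escape_rate_exists S (eta w) w,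
      escape_rate S (nu0 w) w = \int[m]_w (log_ratio w)%:E &
      escape_rate S (eta w) w = \int[m]_w (log_ratio w)%:E]%E}.
Proof.
have ms := shift_measurable base; have ps := shift_preserving base.
have es := shift_ergodic base; have [C C0] := moderate_positive.
have freq := frequent_visits ms ps es (measurable_moderate C) C0.
have birk := birkhoff_ergodic ms ps es measurable_log_ratio integrable_log_ratio.
apply: filterS3 (ae_comp_iter ms ps ae_generic_orbit)
  (ae_comp_preserving ms ps freq) (ae_comp_preserving ms ps birk) => w.
exact: escape_rates_generic.
Qed.

End escape_rates.

Theorem theorem4 (R : realType) (d : measure_display)
    (Omega : measurableType d) (m : probability Omega R)
    (S : open_system Omega R)
    (nu0 : R.-pker Omega ~> R) (lam0 : Omega -> R) (phi0 : Omega -> R -> R)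
    (calA Zhat : Omega -> nat -> set (set R))
    (nu : Omega -> probability R R) (lam : Omega -> R)
    (phi : Omega -> R -> R) (eta : Omega -> probability R R) :
  base_system S m ->
  closed_system S m nu0 lam0 phi0 ->
  holes S m nu0 ->
  Q_assumptions S m calA Zhat ->
  associated S m nu0 nu lam phi eta ->
  {ae m, forall w,
    [/\ escape_rate_exists S (nu0 w) w,
        escape_rate_exists S (eta w) w,
        escape_rate S (nu0 w) w = escape_rate S (eta w) w &
        escape_rate S (eta w) w =
          (expected_pressure m lam0 - expected_pressure m lam)%E]} /\
  (expected_pressure m lam0 - expected_pressure m lam)%E =
    (\int[m]_w lne (lam0 w / lam w)%:E)%E.
Proof.
move=> base closed holed Qs assoc.
have pressureE := integral_log_ratio closed assoc; split; last first.
  by rewrite (integral_lne_ratio closed assoc) pressureE.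
apply: filterS (ae_escape_rates base closed holed Qs assoc) => w [? ? nuE etaE].
by split => //; [rewrite nuE etaE|rewrite etaE].
Qed.
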